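(* For all $u,v\in\mathbb{R}$, $$\lim_{n\to\infty}n^{-1/6}K_n\big(2\sqrt n+n^{-1/6}u,\;2\sqrt n+n^{-1/6}v\big)=K_{\mathrm{Ai}}(u,v),$$ where $K_{\mathrm{Ai}}$ is the Airy kernel $$K_{\mathrm{Ai}}(u,v)=\frac{\mathrm{Ai}(u)\mathrm{Ai}'(v)-\mathrm{Ai}'(u)\mathrm{Ai}(v)}{u-v},$$ extended to the diagonal $u=v$ by continuity.
   Context: $He_n(x)=\mathbb{E}_{Z\sim\mathcal{N}(0,1)}[(x+\imath Z)^n]$ ($\imath=\sqrt{-1}$) is the probabilist's Hermite polynomial, $\Psi_j(x)=\frac{1}{\sqrt{j!}}He_j(x)\sqrt{\frac{1}{\sqrt{2\pi}}e^{-\frac12x^2}}$, and the Hermite kernel of order $n$ is $K_n(x,y)=\sum_{j=0}^{n-1}\Psi_j(x)\Psi_j(y)$. $\mathrm{Ai}$ is the Airy function, $\mathrm{Ai}(u)=\frac{1}{2\pi \imath}\int_{\mathcal C}\exp\{\frac{t^3}{3}-ut\}\,dt$, where $\mathcal C$ consists of the two rays from the origin at angles $-\pi/3$ and $\pi/3$, oriented from $e^{-\imath\pi/3}\infty$ to $e^{\imath\pi/3}\infty$. *)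

(* Defs.v *)
From HB Require Import structures.
From mathcomp Require Import all_boot all_order all_algebra.
From mathcomp Require Import all_classical all_reals all_analysis.
From mathcomp Require Import complex.
From mathcomp Require Import measurable_realfun.

Set Implicit Arguments.
Unset Strict Implicit.
Unset Printing Implicit Defensive.

Import Order.TTheory GRing.Theory Num.Theory.
Import numFieldNormedType.Exports.

Local Open Scope classical_set_scope.
Local Open Scope ring_scope.
Local Open Scope complex_scope.

Definition cexp (R : realType) (z : R[i]) : R[i] :=
  (expR (complex.Re z))%:C * (cos (complex.Im z) +i* sin (complex.Im z)).

Lemma cexp_conj (R : realType) (z : R[i]) : cexp z^*%C = (cexp z)^*%C.
Proof.
case: z => a b; rewrite /cexp /= cosN sinN; simpc.
by rewrite ?mulrN.
Qed.

Definition cexpectation d (T : measurableType d) (R : realType)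
    (P : probability T R) (X : T -> R[i]) : R[i] :=
  fine 'E_P[fun w => complex.Re (X w)] +i* fine 'E_P[fun w => complex.Im (X w)].

Definition cintegral d (T : measurableType d) (R : realType)
    (mu : {measure set T -> \bar R}) (D : set T) (f : T -> R[i]) : R[i] :=
  (\int[mu]_(x in D) complex.Re (f x))%R +i* (\int[mu]_(x in D) complex.Im (f x))%R.

Definition hermiteC (R : realType) (n : nat) (x : R) : R[i] :=
  cexpectation (normal_prob 0 1) (fun z : R => (x +i* z) ^+ n).

Lemma measurable_ReImX (R : realType) (x : R) n :
  measurable_fun [set: R] (fun z : R => complex.Re ((x +i* z) ^+ n)) /\
  measurable_fun [set: R] (fun z : R => complex.Im ((x +i* z) ^+ n)).
Proof.
elim: n => [|n [IHr IHi]]; first by split; exact: measurable_cst.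
have e z : (x +i* z) ^+ n.+1 =
  (x * complex.Re ((x +i* z) ^+ n) - z * complex.Im ((x +i* z) ^+ n)) +i*
  (x * complex.Im ((x +i* z) ^+ n) + z * complex.Re ((x +i* z) ^+ n)).
  by rewrite exprS; case: (_ ^+ n).
split; under eq_fun do rewrite e /=.
  by apply: measurable_funB; apply: measurable_funM.
by apply: measurable_funD; apply: measurable_funM.
Qed.

Lemma normal_probN (R : realType) (A : set R) : measurable A ->
  pushforward (normal_prob 0 1) (-%R : R -> measurableTypeR R) A =
  normal_prob 0 1 A.
Proof.
move=> mA; rewrite /pushforward /normal_prob.
transitivity (\int[pushforward lebesgue_measure (-%R : R -> measurableTypeR R)]_(x in A)
   (normal_pdf (0:R) 1 x)%:E)%E; last first.
  by apply: eq_measure_integral => B mB _; exact: lebesgue_measureN.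
rewrite ge0_integral_pushforward//=.
- apply: eq_integral => z _ /=; congr EFin.
  by rewrite /normal_pdf oner_eq0 /normal_fun !subr0 sqrrN.
- apply/measurable_EFinP; apply: measurable_funTS; exact: measurable_normal_pdf.
- by move=> z _; rewrite lee_fin normal_pdf_ge0.
Qed.

Lemma hermiteC_real (R : realType) (n : nat) (x : R) : complex.Im (hermiteC n x) = 0.
Proof.
rewrite /hermiteC /= expectation.unlock.
set f := fun z : R => (complex.Im ((x +i* z) ^+ n))%:E.
have mf : measurable_fun setT f by apply/measurable_EFinP; case: (measurable_ReImX x n).
have fN z : f (- z) = (- f z)%E.
  rewrite /f -EFinN; congr EFin.
  by rewrite -[x -i* z]/((x +i* z)^*%C) -rmorphXn /=; case: (_ ^+ n).
rewrite integralE.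
suff -> : (\int[normal_prob 0 1]_z (f^\- z) = \int[normal_prob 0 1]_z (f^\+ z))%E.
  by case: (integral _ _ _) => //= r; rewrite subrr.
rewrite -[RHS](@eq_measure_integral _ _ _ _ _
   (pushforward (normal_prob 0 1) (-%R : R -> measurableTypeR R))); last first.
  by move=> B mB _; exact: normal_probN.
rewrite ge0_integral_pushforward//=; last exact: measurable_funepos.
by apply: eq_integral => z _; rewrite /= funeposE funenegE fN.
Qed.

(* By [hermiteC_real], taking the real part loses nothing. *)
Definition hermite (R : realType) (n : nat) (x : R) : R := complex.Re (hermiteC n x).

Definition hermite_fun (R : realType) (j : nat) (x : R) : R :=
  (Num.sqrt (j`!)%:R)^-1 * hermite j x *
    Num.sqrt ((Num.sqrt (2 * pi))^-1 * expR (- (2^-1 * x ^+ 2))).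

Definition hermite_kernel (R : realType) (n : nat) (x y : R) : R :=
  \sum_(j < n) hermite_fun j x * hermite_fun j y.

(* Integral of f along the ray from 0 at angle theta, oriented outwards. *)
Definition ray_integral (R : realType) (theta : R) (f : R[i] -> R[i]) : R[i] :=
  let w := cexp (0 +i* theta) in
  cintegral lebesgue_measure `[0, +oo[ (fun s : R => f (s%:C * w) * w).

(* The contour comes in along the ray of angle -pi/3 and leaves along the ray
   of angle pi/3, so the outward integral along the former is subtracted. *)
Definition airyC (R : realType) (u : R) : R[i] :=
  let f (t : R[i]) := cexp (t ^+ 3 / 3%:R - u%:C * t) in
  (0 +i* (2 * pi))^-1 *
    (ray_integral (pi / 3) f - ray_integral (- (pi / 3)) f).

Lemma RintegralN_total d (T : measurableType d) (R : realType)
    (mu : {measure set T -> \bar R}) (D : set T) (f : T -> R) :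
  \int[mu]_(x in D) (- f x) = - \int[mu]_(x in D) f x.
Proof.
rewrite /Rintegral [in RHS]integralE [in LHS]integralE.
have -> : (fun x => (- f x)%:E) = (\- (EFin \o f))%E by apply/funext.
rewrite funeposN funenegN.
set a := integral _ _ _; set b := integral _ _ _.
by case: a b => [a||] [b||] //=; rewrite ?oppr0// opprB.
Qed.

Lemma ray_integral_conj (R : realType) (theta : R) (f : R[i] -> R[i]) :
  (forall z, f z^*%C = (f z)^*%C) ->
  ray_integral (- theta) f = (ray_integral theta f)^*%C.
Proof.
move=> fJ; rewrite /ray_integral /cintegral /=.
rewrite -[0 -i* theta]/((0 +i* theta)^*%C) cexp_conj.
set w := cexp _.
have e (s : R) : f (s%:C * w^*%C) * w^*%C = (f (s%:C * w) * w)^*%C.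
  by rewrite -[s%:C in LHS]conjc_real -rmorphM fJ -rmorphM.
under eq_Rintegral do rewrite e.
under [X in _ +i* X]eq_Rintegral do rewrite e.
rewrite -RintegralN_total; congr (_ +i* _).
  by apply: eq_Rintegral => s _; case: (_ * w).
by apply: eq_Rintegral => s _; case: (_ * w).
Qed.

Lemma airyC_real (R : realType) (u : R) : complex.Im (airyC u) = 0.
Proof.
rewrite /airyC ray_integral_conj; last first.
  move=> z; rewrite -cexp_conj; congr cexp.
  have e3 : ((3%:R : R[i])^-1)^*%C = 3%:R^-1 by rewrite conjc_inv conjc_nat.
  rewrite rmorphB (rmorphM _ (z ^+ 3)) rmorphXn (rmorphM _ u%:C).
  by rewrite -[in LHS]e3 -[in LHS](conjc_real u).
set I := ray_integral _ _; by case: I => a b; simpc.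
Qed.

(* By [airyC_real], taking the real part loses nothing. *)
Definition airy (R : realType) (u : R) : R := complex.Re (airyC u).

Definition airy_quotient (R : realType) (u v : R) : R :=
  (airy u * (@airy R)^`()%classic v - (@airy R)^`()%classic u * airy v) / (u - v).

(* On the diagonal: the limit of the quotient over all pairs (x, y) with x <> y
   tending to (u, v). *)
Definition airy_kernel (R : realType) (u v : R) : R :=
  if u == v then
    lim (airy_quotient p.1 p.2
           @[p --> within [set p : R * R | p.1 != p.2] (nbhs (u, v))])
  else airy_quotient u v.

(* Main.v *)
Require Import Defs.
From mathcomp Require Import all_boot all_order all_algebra.
From mathcomp Require Import all_classical all_reals all_analysis.
From mathcomp Require Import complex measurable_realfun ring lra.

(** The proof is the method of steepest descent, arranged so that every contour
is a single ray and every integral a real integral over the half-line.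

Write w for the point e^(i pi/3) and let all integrals run over s >= 0. Both
functions in play are imaginary parts of integrals along a ray:
- [airyE]: pi Ai(u) = Im of the integral of exp(t^3/3 - ut) along t = s w,
  where t^3 = - s^3;
- [hermiteE]: sqrt(pi/2) He_k(x) = Im of the integral of z^k exp((z - x)^2/2)
  along z = c + s (p + ih), for any real c and any direction p + ih with h > 0
  and 2 p^2 < h^2. By symmetry in Z, the definition E[(x + iZ)^k] is the case
  c = x of the vertical ray. The integral is the same on the other rays because
  integrating the derivative of z^k exp((z - x)^2/2) along a ray starting on
  the real axis leaves a real boundary term, so that the three-term recurrence
  He_(k+1) = x He_k - k He_(k-1) holds on each ray ([hermite_integral_rec]),
  and because for k = 0 the ray can be moved continuously to the vertical one
  ([gauss_integral_ray]).

Put q = n^(1/6), m = q^2 and x = 2 q^3 + u/q. The function z^n exp((z - x)^2/2)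
has a double saddle point near z = sqrt n = q^3. On the ray
z = q^3 + s q w = q^3 (1 + y), y = s w/m, it equals an explicit constant times
saddle(y)^n exp(-u s w), where saddle(y) = (1 + y) exp(-y + y^2/2). Since
saddle(y) = exp(y^3/3) (1 + O(y^4)) and n y^3 = - s^3, the power saddle(y)^n
tends to exp(-s^3/3) ([saddle_power_sub]), and |saddle(y)|^n <= exp((s -
s^2)/4) whenever m >= 1 ([normc_saddle_power]). By dominated convergence, and
up to the factor pi, the rescaled He_n tends to Ai(u) and the rescaled
difference m (He_n - sqrt n He_(n-1)) tends to - Ai'(u) ([cvg_pre_airy],
[cvg_pre_airy1]).

The Christoffel-Darboux formula, and its confluent form on the diagonal,
express K_n exactly through these two quantities at x and at y, with a
prefactor in which all exponentials cancel up to Stirling's formula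
([hermite_kernel_offdiag], [hermite_kernel_ondiag], [edge_weightE]); taking the
difference He_n - sqrt n He_(n-1) instead of He_(n-1) absorbs the cancellation
of the leading terms. Stirling's formula is proved by Laplace's method applied
to the integral of r^(2n+1) exp(-r^2/2) over r >= 0, which is 2^n n!
([stirling]). On the diagonal, the limit Ai'(u)^2 - u Ai(u)^2 is identified
with the continuous extension of the Airy quotient by the mean value theorem
and Ai'' = u Ai ([airy_kernel_diag]). *)

Set Implicit Arguments.
Unset Strict Implicit.
Unset Printing Implicit Defensive.
Import Order.TTheory GRing.Theory Num.Theory.
Import numFieldNormedType.Exports.
Import Normc.
Local Open Scope classical_set_scope.
Local Open Scope ring_scope.
Local Open Scope complex_scope.

Local Notation Re := complex.Re.
Local Notation Im := complex.Im.

(** * Complex numbers and curves *)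

Section complex_numbers.
Variable R : realType.
Implicit Types (z w : R[i]) (a : R).

Lemma Re_add z w : Re (z + w) = Re z + Re w. Proof. by case: z; case: w. Qed.
Lemma Im_add z w : Im (z + w) = Im z + Im w. Proof. by case: z; case: w. Qed.
Lemma Re_opp z : Re (- z) = - Re z. Proof. by case: z. Qed.
Lemma Im_opp z : Im (- z) = - Im z. Proof. by case: z. Qed.
Lemma Re_mul z w : Re (z * w) = Re z * Re w - Im z * Im w.
Proof. by case: z => a b; case: w. Qed.
Lemma Im_mul z w : Im (z * w) = Re z * Im w + Im z * Re w.
Proof. by case: z => a b; case: w. Qed.
Lemma Re_scale a z : Re (a%:C * z) = a * Re z.
Proof. by rewrite Re_mul /= mul0r subr0. Qed.
Lemma Im_scale a z : Im (a%:C * z) = a * Im z.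
Proof. by rewrite Im_mul /= mul0r addr0. Qed.

Lemma eq_ReIm z w : Re z = Re w -> Im z = Im w -> z = w.
Proof. by case: z => a b; case: w => c d /= -> ->. Qed.

Lemma normc_norm z : (normc z)%:C = `|z|. Proof. by []. Qed.

Lemma normc_ge0 z : 0 <= normc z. Proof. by case: z => a b; exact: sqrtr_ge0. Qed.

Lemma normcD z w : normc (z + w) <= normc z + normc w.
Proof. exact: le_normcD. Qed.

Lemma normcB z w : normc (z - w) <= normc z + normc w.
Proof. by rewrite (le_trans (normcD _ _))// normcN. Qed.

Lemma normcX z n : normc (z ^+ n) = normc z ^+ n.
Proof. by elim: n => [|n IH]; rewrite ?expr0 ?normc1// !exprS normcM IH. Qed.

Lemma normcR a : normc a%:C = `|a|.
Proof. by rewrite /= expr0n /= addr0 sqrtr_sqr. Qed.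

Lemma normc_Re z : `|Re z| <= normc z.
Proof. by rewrite -lecR normc_norm; exact: normc_ge_Re. Qed.

Lemma normc_Im z : `|Im z| <= normc z.
Proof.
case: z => a b /=; rewrite -sqrtr_sqr ler_sqrt ?addr_ge0 ?sqr_ge0//.
by rewrite lerDr sqr_ge0.
Qed.

Lemma normc_leD z : normc z <= `|Re z| + `|Im z|.
Proof.
case: z => a b /=.
rewrite -[leRHS]ger0_norm ?addr_ge0// -sqrtr_sqr ler_sqrt ?sqr_ge0//.
by rewrite sqrrD !real_normK ?num_real// -addrA lerD2l lerDr mulrn_wge0// mulr_ge0.
Qed.

Lemma cexpD z w : cexp (z + w) = cexp z * cexp w.
Proof.
rewrite /cexp Re_add Im_add expRD cosD sinD rmorphM /=.
by apply: eq_ReIm; rewrite !(Re_mul, Im_mul) /=; ring.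
Qed.

Lemma Re_cexp z : Re (cexp z) = expR (Re z) * cos (Im z).
Proof. exact: Re_scale. Qed.

Lemma Im_cexp z : Im (cexp z) = expR (Re z) * sin (Im z).
Proof. exact: Im_scale. Qed.

Lemma cexp0 : cexp (0 : R[i]) = 1.
Proof. by rewrite /cexp /= expR0 cos0 sin0 mul1r. Qed.

Lemma cexpR a : cexp a%:C = (expR a)%:C.
Proof. by rewrite /cexp /= cos0 sin0 mulr1. Qed.

Lemma cexpMn n z : cexp (n%:R * z) = cexp z ^+ n.
Proof.
elim: n => [|n IH]; first by rewrite mul0r cexp0.
by rewrite -natr1 mulrDl mul1r cexpD IH exprSr.
Qed.

Lemma normc_cexp z : normc (cexp z) = expR (Re z).
Proof.
rewrite /cexp normcM normcR ger0_norm ?expR_ge0// /= cos2Dsin2 sqrtr1.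
by rewrite mulr1.
Qed.

End complex_numbers.

Section complex_derivative.
Variable R : realType.
Implicit Types (f g : R -> R[i]) (s : R) (z : R[i]).

(** The derivative of a curve in the complex plane with respect to its real
parameter, taken componentwise: the scalars are those of the real line. *)
Definition is_cderive f s z :=
  is_derive s 1 (fun x => Re (f x)) (Re z) /\ is_derive s 1 (fun x => Im (f x)) (Im z).

Lemma is_cderive_eq f s z w : is_cderive f s z -> z = w -> is_cderive f s w.
Proof. by move=> ? <-. Qed.

Lemma is_cderive_cst z s : is_cderive (fun=> z) s 0.
Proof. by split; exact: is_derive_cst. Qed.

Lemma is_cderive_id s : is_cderive (fun x => x%:C) s 1.
Proof. by split; [exact: is_derive_id|exact: is_derive_cst]. Qed.

Lemma is_cderiveD f g s z w : is_cderive f s z -> is_cderive g s w ->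
  is_cderive (fun x => f x + g x) s (z + w).
Proof.
move=> [f1 f2] [g1 g2]; rewrite /is_cderive Re_add Im_add; split.
- rewrite (_ : (fun x => Re (f x + g x)) =
      (fun x => Re (f x)) + (fun x => Re (g x))).
    exact: is_deriveD.
  by apply/funext => x /=; rewrite Re_add.
- rewrite (_ : (fun x => Im (f x + g x)) =
      (fun x => Im (f x)) + (fun x => Im (g x))).
    exact: is_deriveD.
  by apply/funext => x /=; rewrite Im_add.
Qed.

Lemma is_cderiveM f g s z w : is_cderive f s z -> is_cderive g s w ->
  is_cderive (fun x => f x * g x) s (z * g s + f s * w).
Proof.
move=> [f1 f2] [g1 g2]; rewrite /is_cderive; split.
- rewrite (_ : (fun x => Re (f x * g x)) =
      (fun x => Re (f x)) * (fun x => Re (g x)) -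
      (fun x => Im (f x)) * (fun x => Im (g x))).
    by apply: is_derive_eq; rewrite !(Re_add, Re_mul) /= /GRing.scale/=; ring.
  by apply/funext => x /=; rewrite Re_mul.
- rewrite (_ : (fun x => Im (f x * g x)) =
      (fun x => Re (f x)) * (fun x => Im (g x)) +
      (fun x => Im (f x)) * (fun x => Re (g x))).
    by apply: is_derive_eq; rewrite !(Im_add, Im_mul) /= /GRing.scale/=; ring.
  by apply/funext => x /=; rewrite Im_mul.
Qed.

Lemma is_cderiveX f s z n : is_cderive f s z ->
  is_cderive (fun x => f x ^+ n) s (n%:R * f s ^+ n.-1 * z).
Proof.
move=> df; elim: n => [|n IH].
  apply: (@is_cderive_eq _ _ 0); first exact: is_cderive_cst.
  by rewrite !mul0r.
rewrite (_ : (fun _ => _) = (fun x => f x * f x ^+ n)); last first.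
  by apply/funext => x; rewrite exprS.
apply: is_cderive_eq; first exact: (is_cderiveM df IH).
case: n {IH} => [|n] /=; first by rewrite !expr0; ring.
by rewrite !exprS -[in RHS]natr1; ring.
Qed.

Lemma is_cderive_cexp f s z : is_cderive f s z ->
  is_cderive (fun x => cexp (f x)) s (cexp (f s) * z).
Proof.
move=> [f1 f2].
have dE : is_derive s 1 (fun x => expR (Re (f x))) (expR (Re (f s)) * Re z).
  by apply: is_derive_eq (is_derive1_comp _ _) _; rewrite /= mulrC.
have dC : is_derive s 1 (fun x => cos (Im (f x))) (- sin (Im (f s)) * Im z).
  by apply: is_derive_eq (is_derive1_comp _ _) _; rewrite /= mulrC.
have dS : is_derive s 1 (fun x => sin (Im (f x))) (cos (Im (f s)) * Im z).
  by apply: is_derive_eq (is_derive1_comp _ _) _; rewrite /= mulrC.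
rewrite /is_cderive; split.
- rewrite (_ : (fun x => Re (cexp (f x))) = (fun x => expR (Re (f x))) * (fun x => cos (Im (f x)))).
    by apply: is_derive_eq; rewrite /cexp !(Re_mul, Im_mul) /= /GRing.scale/=; ring.
  by apply/funext => x; exact: Re_cexp.
- rewrite (_ : (fun x => Im (cexp (f x))) = (fun x => expR (Re (f x))) * (fun x => sin (Im (f x)))).
    by apply: is_derive_eq; rewrite /cexp !(Re_mul, Im_mul) /= /GRing.scale/=; ring.
  by apply/funext => x; exact: Im_cexp.
Qed.

Definition cderivable f := forall s, exists z, is_cderive f s z.

Lemma cderivable_Im f : cderivable f -> forall s, derivable (fun x => Im (f x)) s 1.
Proof. by move=> df s; have [z [_ [+ _]]] := df s. Qed.

Lemma cderivable_continuous_Im f : cderivable f -> continuous (fun x => Im (f x)).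
Proof.
by move=> df s; apply/differentiable_continuous/derivable1_diffP/cderivable_Im.
Qed.

End complex_derivative.

(** * Integrals over the half-line *)

Section half_line_integrals.
Variable R : realType.
Local Notation mu := (@lebesgue_measure R).

Lemma derivable_continuous (F f : R -> R) :
  (forall s : R, is_derive s 1 F (f s)) -> continuous F.
Proof.
by move=> dF s; apply/differentiable_continuous/derivable1_diffP.
Qed.

Lemma continuous_measurable_EFin (D : set R) (f : R -> R) :
  continuous f -> measurable_fun D (fun s => (f s)%:E).
Proof.
move=> cf; apply/measurable_EFinP; apply: measurable_funTS.
exact: continuous_measurable_fun.
Qed.

Lemma integral_FTC2y_ge0 (a : R) (f F : R -> R) (l : R) :
  (forall s : R, is_derive s 1 F (f s)) -> continuous f ->
  (forall s, a <= s -> 0 <= f s) -> F s @[s --> +oo] --> l ->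
  (\int[mu]_(s in `[a, +oo[) (f s)%:E = (l - F a)%:E)%E.
Proof.
move=> dF cf f0 Fl; rewrite (@ge0_continuous_FTC2y _ f F a l)//.
- exact: continuous_subspaceT.
- by apply: cvg_at_right_filter; exact: (derivable_continuous dF).
- by move=> x _; rewrite derive1E; have [_ ->] := dF x.
Qed.

Lemma is_derive_expRN (C s : R) :
  is_derive s 1 (fun s => - (C * expR (- s))) (C * expR (- s)).
Proof.
have -> : (fun s => - (C * expR (- s))) = (fun s => (- C) * (expR \o -%R) s).
  by apply/funext => x /=; rewrite mulNr.
by apply: is_derive_eq; rewrite /GRing.scale /= ?scaler0 ?mulr0; ring.
Qed.

Lemma cvg_expRN (C : R) : - (C * expR (- s)) @[s --> +oo] --> 0.
Proof.
rewrite -[X in _ --> X]oppr0 -[X in _ --> - X](mulr0 C).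
by apply: cvgN; apply: cvgM; [exact: cvg_cst|exact: cvgr_expR].
Qed.

Lemma continuous_expRN (C : R) : continuous (fun s => C * expR (- s)).
Proof.
move=> s; apply: cvgM; first exact: cvg_cst.
by apply: continuous_comp; [exact: opp_continuous|exact: continuous_expR].
Qed.

Lemma integral_expRN (C a : R) : 0 <= C ->
  (\int[mu]_(s in `[a, +oo[) (C * expR (- s))%:E = (C * expR (- a))%:E)%E.
Proof.
move=> C0; rewrite (integral_FTC2y_ge0 (is_derive_expRN C) _ _ (cvg_expRN C)).
- by rewrite sub0r opprK.
- exact: continuous_expRN.
- by move=> s _; rewrite mulr_ge0// expR_ge0.
Qed.

Lemma integrable_expRN (C a : R) : 0 <= C ->
  mu.-integrable `[a, +oo[ (fun s => (C * expR (- s))%:E).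
Proof.
move=> C0; apply/integrableP; split.
  by apply: continuous_measurable_EFin; exact: continuous_expRN.
have -> : (\int[mu]_(s in `[a, +oo[) `|(C * expR (- s))%:E| =
    \int[mu]_(s in `[a, +oo[) (C * expR (- s))%:E)%E.
  by apply: eq_integral => s _; rewrite gee0_abs// lee_fin mulr_ge0// expR_ge0.
by rewrite integral_expRN// ltry.
Qed.

Lemma integrable_decay (C a : R) (f : R -> R) : continuous f ->
  (forall s, a <= s -> `|f s| <= C * expR (- s)) ->
  mu.-integrable `[a, +oo[ (EFin \o f).
Proof.
move=> cf fC.
have C0 : 0 <= C.
  have := le_trans (normr_ge0 _) (fC a (lexx a)).
  by rewrite pmulr_lge0// expR_gt0.
apply: (le_integrable _ _ _ (@integrable_expRN C a C0)) => //.
  exact: continuous_measurable_EFin.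
move=> s /=; rewrite in_itv/= andbT => sa.
by rewrite lee_fin (le_trans (fC _ sa))// ler_norm.
Qed.

(** Adding C exp(- s) to f makes it nonnegative, which reduces the signed case to
the nonnegative one. *)
Lemma Rintegral_FTC2y_decay (C a : R) (f F : R -> R) :
  (forall s : R, is_derive s 1 F (f s)) -> continuous f ->
  (forall s, a <= s -> `|f s| <= C * expR (- s)) ->
  (forall s, a <= s -> `|F s| <= C * expR (- s)) ->
  \int[mu]_(s in `[a, +oo[) f s = - F a.
Proof.
move=> dF cf fC FC.
have C0 : 0 <= C.
  have := le_trans (normr_ge0 _) (fC a (lexx a)).
  by rewrite pmulr_lge0// expR_gt0.
have ie := @integrable_expRN C a C0.
have jf := integrable_decay cf fC.
have F0 : F s @[s --> +oo] --> 0.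
  apply/cvgr0Pnorm_le => e e0.
  have /cvgrPdist_le/(_ _ e0) := cvg_expRN C.
  move=> h; near=> s.
  have sa : a <= s by near: s; apply: nbhs_pinfty_ge; exact: num_real.
  rewrite (le_trans (FC s sa))// (le_trans (ler_norm _))//.
  by rewrite -[X in `|X|]opprK -[X in `|X|]sub0r; near: s.
pose g s := f s + C * expR (- s).
pose G s := F s + - (C * expR (- s)).
have dG (s : R) : is_derive s 1 G (g s).
  by apply: is_deriveD; exact: is_derive_expRN.
have cg : continuous g by move=> s; apply: cvgD; [exact: cf|exact: continuous_expRN].
have g0 s : a <= s -> 0 <= g s.
  by move=> /fC; rewrite ler_norml /g => /andP[+ _]; rewrite -subr_ge0 opprK.
have Gl : G s @[s --> +oo] --> (0 : R).
  by rewrite -[X in _ --> X]addr0; apply: cvgD => //; exact: cvg_expRN.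
have := integral_FTC2y_ge0 dG cg g0 Gl.
move/(congr1 (@fine R)); rewrite /= -/(Rintegral _ _ _) /g RintegralD//.
rewrite {2}/Rintegral integral_expRN//= /G sub0r opprD opprK.
by move/addIr.
Unshelve. all: by end_near. Qed.

End half_line_integrals.

Section imaginary_integral.
Variable R : realType.
Local Notation mu := (@lebesgue_measure R).
Implicit Types (f g F : R -> R[i]) (C : R).

(** Only imaginary parts of integrals along rays are ever used: the two rays of
the Airy contour, and the two halves of the vertical line on which He_n lives,
are complex conjugate to each other. *)
Definition Im_integral f : R := \int[mu]_(s in `[0, +oo[) Im (f s).

(** Every integrand below decays faster than any exponential, so that the single
majorant C exp(- s) serves for integrability, for boundary terms at infinity and
for dominated convergence alike. *)
Definition dominated C f := forall s : R, 0 <= s -> normc (f s) <= C * expR (- s).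

Lemma dominated_Im C f : dominated C f ->
  forall s : R, 0 <= s -> `|Im (f s)| <= C * expR (- s).
Proof. by move=> fC s /fC; apply: le_trans; exact: normc_Im. Qed.

Lemma dominated_ge0 C f : dominated C f -> 0 <= C.
Proof.
move=> fC; have := le_trans (normc_ge0 _) (fC 0 (lexx 0)).
by rewrite oppr0 expR0 mulr1.
Qed.

Lemma dominatedW C C' f : C <= C' -> dominated C f -> dominated C' f.
Proof. by move=> CC fC s /fC/le_trans; apply; rewrite ler_pM2r// expR_gt0. Qed.

Lemma integrable_Im C f : cderivable f -> dominated C f ->
  mu.-integrable `[0, +oo[ (fun s => (Im (f s))%:E).
Proof.
move=> df fC.
exact: (integrable_decay (cderivable_continuous_Im df) (dominated_Im fC)).
Qed.

Lemma dominatedD C C' f g : dominated C f -> dominated C' g ->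
  dominated (C + C') (fun s => f s + g s).
Proof.
by move=> fC gC' s s0; rewrite mulrDl (le_trans (normcD _ _))// lerD ?fC ?gC'.
Qed.

Lemma dominatedZ C f (a : R) : dominated C f ->
  dominated (`|a| * C) (fun s => a%:C * f s).
Proof. by move=> fC s s0; rewrite normcM normcR -mulrA ler_wpM2l// fC. Qed.

Lemma Im_integralD C C' f g : cderivable f -> cderivable g ->
  dominated C f -> dominated C' g ->
  Im_integral (fun s => f s + g s) = Im_integral f + Im_integral g.
Proof.
move=> df dg fC gC'; rewrite /Im_integral -RintegralD//.
- by apply: eq_Rintegral => s _; rewrite Im_add.
- exact: integrable_Im fC.
- exact: integrable_Im gC'.
Qed.

Lemma Im_integralZ C f (a : R) : cderivable f -> dominated C f ->
  Im_integral (fun s => a%:C * f s) = a * Im_integral f.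
Proof.
move=> df fC; rewrite /Im_integral -RintegralZl//.
- by apply: eq_Rintegral => s _; rewrite Im_scale.
- exact: integrable_Im fC.
Qed.

Lemma eq_Im_integral f g : (forall s : R, 0 <= s -> f s = g s) ->
  Im_integral f = Im_integral g.
Proof.
move=> fg; apply: eq_Rintegral => s; rewrite inE/= in_itv/= andbT => s0.
by rewrite fg.
Qed.

(** When F 0 is real this vanishes: it is the form in which Cauchy's theorem and
integration by parts are used. *)
Lemma Im_integral_FTC C C' f F : (forall s, is_cderive F s (f s)) ->
  cderivable f -> dominated C f -> dominated C' F ->
  Im_integral f = - Im (F 0).
Proof.
move=> dF df fC FC'.
have C0 := dominated_ge0 fC; have C'0 := dominated_ge0 FC'.
apply: (@Rintegral_FTC2y_decay _ (C + C') 0 (fun s => Im (f s)) (fun s => Im (F s))).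
- by move=> s; have [] := dF s.
- exact: cderivable_continuous_Im.
- by apply: dominated_Im; apply: dominatedW fC; rewrite lerDl.
- by apply: dominated_Im; apply: dominatedW FC'; rewrite lerDr.
Qed.

Lemma cvg_Im_integral C (f_ : nat -> R -> R[i]) f :
  (forall n, cderivable (f_ n)) -> cderivable f ->
  (forall n, dominated C (f_ n)) ->
  (forall s : R, 0 <= s -> normc (f_ n s - f s) @[n --> \oo] --> 0) ->
  Im_integral (f_ n) @[n --> \oo] --> Im_integral f.
Proof.
move=> df_ df fC fl.
have C0 := dominated_ge0 (fC 0%N).
have mS (g : R -> R[i]) : cderivable g ->
    measurable_fun (`[0%R, +oo[%classic : set R) (fun s => (Im (g s))%:E).
  move=> dg; apply: continuous_measurable_EFin.
  exact: cderivable_continuous_Im.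
have [] := @dominated_convergence _ _ R mu `[0%R, +oo[%classic (measurable_itv `[0%R, +oo[)
  (fun n s => (Im (f_ n s))%:E) (fun s => (Im (f s))%:E)
  (fun s => (C * expR (- s))%:E).
- by move=> n; exact: mS.
- exact: mS.
- apply: aeW => s /=; rewrite in_itv/= andbT => s0.
  apply/cvg_EFin; first by near=> n.
  apply/subr_cvg0 => /=.
  apply: norm_cvg0; apply: squeeze_cvgr (fl s s0); last exact: cvg_cst.
  by near=> n; rewrite normr_ge0 -Im_opp -Im_add normc_Im.
- exact: integrable_expRN.
- apply: aeW => s n /=; rewrite in_itv/= andbT => s0.
  by rewrite lee_fin (dominated_Im (fC n)).
move=> i _ /= h; apply: (fine_cvg h _ _) || apply/fine_cvg.
rewrite /Im_integral /Rintegral fineK//.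
exact: integrable_fin_num.
Unshelve. all: by end_near. Qed.

Lemma is_derive_Im_integral C C' (f f' : R -> R -> R[i]) (a u v : R) : u < a < v ->
  (forall x, u < x < v -> cderivable (f x) /\ dominated C (f x)) ->
  (forall x s : R, u < x < v -> 0 <= s -> is_cderive (f^~ s) x (f' x s)) ->
  (forall x, u < x < v -> dominated C' (f' x)) ->
  is_derive a 1 (fun x => Im_integral (f x)) (Im_integral (f' a)).
Proof.
move=> /andP[ua av] fC df' f'C.
have uav : u < a < v by rewrite ua.
have C'0 := dominated_ge0 (f'C a uav).
have d1E (x s : R) : u < x < v -> 0 <= s ->
    derivable (fun x => Im (f x s)) x 1 /\
    (fun x => Im (f x s))^`()%classic x = Im (f' x s).
  move=> xI s0; have [_ [h1 h2]] := df' x s xI s0; split => //.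
  by rewrite derive1E.
have H1 x : `]u, v[%classic x ->
    mu.-integrable `[0, +oo[ (EFin \o (fun s => Im (f x s))).
  by rewrite /= in_itv/= => /fC[? ?]; apply: integrable_Im; eassumption.
have H2 (x s : R) : `]u, v[%classic x -> `[0, +oo[%classic s ->
    derivable (fun x => Im (f x s)) x 1.
  by rewrite /= !in_itv/= andbT => h1 h2; exact: (d1E x s h1 h2).1.
have H3 : forall s, 0 <= C' * expR (- s) by move=> s; rewrite mulr_ge0// expR_ge0.
have H4 (x s : R) : `]u, v[%classic x -> `[0, +oo[%classic s ->
   `| (fun x => Im (f x s))^`()%classic x | <= C' * expR (- s).
  rewrite /= !in_itv/= andbT => h1 h2; rewrite (d1E x s h1 h2).2.
  exact: (dominated_Im (f'C x h1)).
have Ia : `]u, v[%classic a by rewrite /= in_itv/= ua.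
have iE := @integrable_expRN R C' 0 C'0.
have mI : measurable (`[0%R, +oo[%classic : set R) by exact: (measurable_itv `[0%R, +oo[).
split.
  exact: (@derivable_under_integral R _ _ mu (fun x s => Im (f x s)) _ mI a u v Ia
    H1 H2 _ H3 iE H4).
rewrite -derive1E.
rewrite (@differentiation_under_integral R _ _ mu (fun x s => Im (f x s)) _ mI a u v Ia
  H1 H2 _ H3 iE H4).
apply: eq_Rintegral => s; rewrite inE/= in_itv/= andbT => s0.
exact: (d1E a s uav s0).2.
Qed.

End imaginary_integral.

(** * Exponential and Gaussian bounds *)

Section cderivable_combinators.
Variable R : realType.
Implicit Types (f g : R -> R[i]).

Lemma cderivable_cst (z : R[i]) : cderivable (fun _ : R => z).
Proof. by move=> s; exists 0; exact: is_cderive_cst. Qed.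

Lemma cderivable_id : cderivable (fun s : R => s%:C).
Proof. by move=> s; exists 1; exact: is_cderive_id. Qed.

Lemma cderivableD f g : cderivable f -> cderivable g ->
  cderivable (fun s => f s + g s).
Proof.
move=> df dg s; have [z fz] := df s; have [w gw] := dg s.
by exists (z + w); exact: is_cderiveD.
Qed.

Lemma cderivableM f g : cderivable f -> cderivable g ->
  cderivable (fun s => f s * g s).
Proof.
move=> df dg s; have [z fz] := df s; have [w gw] := dg s.
by exists (z * g s + f s * w); exact: is_cderiveM.
Qed.

Lemma cderivableX f n : cderivable f -> cderivable (fun s => f s ^+ n).
Proof.
by move=> df s; have [z fz] := df s; exists (n%:R * f s ^+ n.-1 * z); exact: is_cderiveX.
Qed.

Lemma cderivable_cexp f : cderivable f -> cderivable (fun s => cexp (f s)).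
Proof.
by move=> df s; have [z fz] := df s; exists (cexp (f s) * z); exact: is_cderive_cexp.
Qed.

Lemma cderivable_affine (c w : R[i]) : cderivable (fun s : R => c + s%:C * w).
Proof.
apply: cderivableD; first exact: cderivable_cst.
by apply: cderivableM; [exact: cderivable_id|exact: cderivable_cst].
Qed.

Lemma is_cderive_affine (c w : R[i]) (s : R) :
  is_cderive (fun s : R => c + s%:C * w) s w.
Proof.
apply: is_cderive_eq.
  apply: is_cderiveD; first exact: is_cderive_cst.
  by apply: is_cderiveM; [exact: is_cderive_id|exact: is_cderive_cst].
by rewrite mulr0 addr0 add0r mul1r.
Qed.

End cderivable_combinators.

Section exponential_bounds.
Variable R : realType.
Implicit Types (A B : R) (f g p : R -> R[i]).

(** Exponential growth, a class stable under the polynomial operations that build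
the factors multiplying a Gaussian. *)
Definition exp_bounded A B p :=
  forall s : R, 0 <= s -> normc (p s) <= A * expR (B * s).

Lemma exp_bounded_ge0 A B p : exp_bounded A B p -> 0 <= A.
Proof.
move=> /(_ 0 (lexx 0)); rewrite mulr0 expR0 mulr1; apply: le_trans.
exact: normc_ge0.
Qed.

Lemma exp_boundedW A A' B B' p : A <= A' -> B <= B' ->
  exp_bounded A B p -> exp_bounded A' B' p.
Proof.
move=> AA BB pAB s s0; rewrite (le_trans (pAB s s0))//.
apply: ler_pM; rewrite ?expR_ge0//; first exact: (exp_bounded_ge0 pAB).
by rewrite ler_expR ler_wpM2r.
Qed.

Lemma exp_bounded_cst (z : R[i]) : exp_bounded (normc z) 0 (fun=> z).
Proof. by move=> s _; rewrite mul0r expR0 mulr1. Qed.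

Lemma exp_bounded_affine (c w : R[i]) :
  exp_bounded (normc c + normc w) 1 (fun s => c + s%:C * w).
Proof.
move=> s s0; rewrite mul1r (le_trans (normcD _ _))// mulrDl normcM normcR.
have es : 1 + s <= expR s := expR_ge1Dx s.
rewrite ger0_norm// mulrC lerD//.
  by rewrite ler_peMr ?normc_ge0//; lra.
by rewrite mulrC [leRHS]mulrC ler_wpM2r ?normc_ge0//; lra.
Qed.

Lemma exp_boundedM A B A' B' f g : exp_bounded A B f -> exp_bounded A' B' g ->
  exp_bounded (A * A') (B + B') (fun s => f s * g s).
Proof.
move=> fb gb s s0; rewrite normcM mulrDl expRD mulrACA.
by apply: ler_pM; rewrite ?normc_ge0 ?fb ?gb.
Qed.

Lemma exp_boundedD A A' B f g : exp_bounded A B f -> exp_bounded A' B g ->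
  exp_bounded (A + A') B (fun s => f s + g s).
Proof.
move=> fb gb s s0; rewrite (le_trans (normcD _ _))// mulrDl.
by rewrite lerD ?fb ?gb.
Qed.

Lemma exp_boundedX A B f n : exp_bounded A B f ->
  exp_bounded (A ^+ n) (n%:R * B) (fun s => f s ^+ n).
Proof.
move=> fb s s0; rewrite normcX -mulrA expRM_natl -exprMn.
by rewrite lerXn2r ?nnegrE ?normc_ge0 ?mulr_ge0 ?expR_ge0 ?(exp_bounded_ge0 fb) ?fb.
Qed.

(** Completing the square in (b + B + 1) s - d s^2 gives the explicit constant,
whose independence of p and e makes the bound uniform over families. *)
Lemma gauss_dominated (A B a b d : R) p e : 0 < d -> exp_bounded A B p ->
  (forall s : R, 0 <= s -> Re (e s) <= a + b * s - d * s ^+ 2) ->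
  dominated (A * expR (a + (b + B + 1) ^+ 2 / (4 * d)))
            (fun s => p s * cexp (e s)).
Proof.
move=> d0 pb eb s s0; rewrite normcM normc_cexp -mulrA -expRD.
have A0 := exp_bounded_ge0 pb.
apply: (le_trans (y := (A * expR (B * s)) * expR (Re (e s)))).
  by rewrite ler_wpM2r ?expR_ge0 ?pb.
rewrite -mulrA -expRD ler_wpM2l// ler_expR.
apply: (le_trans (y := B * s + (a + b * s - d * s ^+ 2))).
  by rewrite lerD2l eb.
have : 0 <= d * (s - (b + B + 1) / (2 * d)) ^+ 2.
  by rewrite mulr_ge0 ?sqr_ge0// ltW.
have -> : d * (s - (b + B + 1) / (2 * d)) ^+ 2 =
   d * s ^+ 2 - (b + B + 1) * s + (b + B + 1) ^+ 2 / (4 * d).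
  by field; rewrite gt_eqF.
by lra.
Qed.

End exponential_bounds.

(** * Hermite integrals along rays *)

Section hermite_ray.
Variable R : realType.
Implicit Types (c x p h b l : R).

Definition ray c p h (s : R) : R[i] := c%:C + s%:C * (p +i* h).

Definition half_sqr (z : R[i]) : R[i] := (2^-1)%:C * z ^+ 2.

(** The integrand z^k exp((z - x)^2/2) dz pulled back to the ray from c; the
Gaussian factor is written on the ray translated by - x. *)
Definition hermite_ray k x c p h (s : R) : R[i] :=
  ray c p h s ^+ k * cexp (half_sqr (ray (c - x) p h s)) * (p +i* h).

Lemma Re_half_sqr_ray b p h (s : R) : Re (half_sqr (ray b p h s)) =
  b ^+ 2 / 2 + b * p * s - (h ^+ 2 - p ^+ 2) / 2 * s ^+ 2.
Proof. by rewrite /half_sqr Re_scale expr2 Re_mul /=; field. Qed.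

Lemma cderivable_ray c p h : cderivable (ray c p h).
Proof. exact: cderivable_affine. Qed.

Lemma is_cderive_ray c p h (s : R) : is_cderive (ray c p h) s (p +i* h).
Proof. exact: is_cderive_affine. Qed.

Lemma is_cderive_half_sqr (f : R -> R[i]) (s : R) z : is_cderive f s z ->
  is_cderive (fun s => half_sqr (f s)) s (f s * z).
Proof.
move=> df; apply: is_cderive_eq.
  apply: is_cderiveM; first exact: is_cderive_cst.
  exact: (is_cderiveX 2 df).
rewrite mul0r add0r expr1 !mulrA.
have -> : (2^-1)%:C * 2 = 1 :> R[i].
  by rewrite -(rmorph_nat (real_complex R) 2) -rmorphM mulVf// rmorph1.
by rewrite mul1r.
Qed.

Lemma cderivable_half_sqr (f : R -> R[i]) : cderivable f ->
  cderivable (fun s => half_sqr (f s)).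
Proof.
move=> df s; have [z fz] := df s.
by exists (f s * z); exact: is_cderive_half_sqr.
Qed.

Lemma exp_bounded_ray c p h :
  exp_bounded (normc c%:C + normc (p +i* h)) 1 (ray c p h).
Proof. exact: exp_bounded_affine. Qed.

Lemma ray_gauss_dominated A B b p h (P : R -> R[i]) : p ^+ 2 < h ^+ 2 ->
  exp_bounded A B P -> exists C, dominated C
    (fun s => P s * cexp (half_sqr (ray b p h s))).
Proof.
move=> ph PAB; eexists.
apply: (@gauss_dominated _ A B (b ^+ 2 / 2) (b * p) ((h ^+ 2 - p ^+ 2) / 2)).
- by rewrite divr_gt0// subr_gt0.
- exact: PAB.
- by move=> s _; rewrite Re_half_sqr_ray.
Qed.

Lemma hermite_ray_cderivable k x c p h : cderivable (hermite_ray k x c p h).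
Proof.
apply: cderivableM; last exact: cderivable_cst.
apply: cderivableM; first exact: (cderivableX k (cderivable_ray c p h)).
exact/cderivable_cexp/cderivable_half_sqr/cderivable_ray.
Qed.

Lemma hermite_ray_dominated k x c p h : p ^+ 2 < h ^+ 2 ->
  exists C, dominated C (hermite_ray k x c p h).
Proof.
move=> ph; have [C HC] := @ray_gauss_dominated _ _ (c - x) p h _ ph
  (exp_boundedM (exp_boundedX k (@exp_bounded_ray c p h))
     (exp_bounded_cst (p +i* h))).
by exists C => s s0; rewrite /hermite_ray mulrAC; exact: HC.
Qed.

Definition hermite_integral k x c p h := Im_integral (hermite_ray k x c p h).

(** The derivative of z^k exp((z - x)^2/2) is
(k z^(k-1) + z^(k+1) - x z^k) exp((z - x)^2/2), and its primitive is real at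
the origin c of the ray. *)
Lemma hermite_integral_rec k x c p h : p ^+ 2 < h ^+ 2 ->
  hermite_integral k.+1 x c p h =
  x * hermite_integral k x c p h - k%:R * hermite_integral k.-1 x c p h.
Proof.
move=> ph.
pose F (s : R) := ray c p h s ^+ k * cexp (half_sqr (ray (c - x) p h s)).
pose f j := hermite_ray j x c p h.
have df j : cderivable (f j) := hermite_ray_cderivable j x c p h.
have [C1 H1] := hermite_ray_dominated k.+1 x c ph.
have [C2 H2] := hermite_ray_dominated k x c ph.
have [C3 H3] := hermite_ray_dominated k.-1 x c ph.
have [C4 FC] := @ray_gauss_dominated _ _ (c - x) p h _ ph
  (exp_boundedX k (@exp_bounded_ray c p h)).
have dF (s : R) : is_cderive F s (k%:R%:C * f k.-1 s + (f k.+1 s + (- x)%:C * f k s)).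
  apply: is_cderive_eq.
    apply: is_cderiveM; first exact: (is_cderiveX k (is_cderive_ray c p h s)).
    exact/is_cderive_cexp/is_cderive_half_sqr/is_cderive_ray.
  rewrite /f /hermite_ray.
  have -> : ray (c - x) p h s = ray c p h s - x%:C.
    by rewrite /ray rmorphB /=; ring.
  by rewrite rmorph_nat rmorphN exprS; ring.
have dxf : cderivable (fun s => (- x)%:C * f k s).
  exact: (cderivableM (cderivable_cst _) (df k)).
have dkf : cderivable (fun s => k%:R%:C * f k.-1 s).
  exact: (cderivableM (cderivable_cst _) (df k.-1)).
have F0 : Im (F 0) = 0.
  rewrite /F /ray !mul0r !addr0 /half_sqr -!rmorphXn -rmorphM cexpR -rmorphM.
  by [].
have Hx := dominatedZ (- x) H2; have H1x := dominatedD H1 Hx.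
have Hk := dominatedZ k%:R H3.
have := Im_integral_FTC dF (cderivableD dkf (cderivableD (df k.+1) dxf))
  (dominatedD Hk H1x) FC.
rewrite (Im_integralD dkf (cderivableD (df k.+1) dxf) Hk H1x).
rewrite (Im_integralD (df k.+1) dxf H1 Hx).
rewrite (Im_integralZ _ (df k) H2) (Im_integralZ _ (df k.-1) H3) F0 oppr0.
rewrite -/(hermite_integral k x c p h) -/(hermite_integral k.-1 x c p h).
by rewrite -/(hermite_integral k.+1 x c p h); lra.
Qed.

End hermite_ray.

(** * Independence of the ray *)

Section gauss_ray.
Variable R : realType.
Local Notation mu := (@lebesgue_measure R).
Implicit Types (b c x p h l : R).

Definition gauss_ray b p h (s : R) : R[i] :=
  (p +i* h) * cexp (half_sqr (ray b p h s)).

(** The deformation parameter l must range over an open interval containing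
[0, 1]; the bound l < 4/3, that is l^2 <= 16/9 < 2, is what the hypothesis
2 p^2 < h^2 allows. *)
Lemma gauss_ray_dominated b p h A B (P : R -> R -> R[i]) : 2 * p ^+ 2 < h ^+ 2 ->
  (forall l, -1 < l < 4 / 3 -> exp_bounded A B (P l)) ->
  exists C, forall l, -1 < l < 4 / 3 ->
    dominated C (fun s => P l s * cexp (half_sqr (ray (l * b) (l * p) h s))).
Proof.
move=> ph PAB; eexists => l lI.
apply: (@gauss_dominated _ A B (8 / 9 * b ^+ 2) (16 / 9 * (b * p))
  (h ^+ 2 / 2 - 8 / 9 * p ^+ 2)).
- have := sqr_ge0 p; lra.
- exact: PAB.
- move=> s s0; rewrite Re_half_sqr_ray.
  have l2 : l ^+ 2 <= 16 / 9.
    by have [l0|l0] := lerP 0 l; nra.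
  have := sqr_ge0 (b + s * p).
  move: lI l2; rewrite !expr2 => lI l2 bs; nra.
Qed.

(** Deform the ray linearly, with origin l b and direction l p + ih. The
derivative in l of exp(z^2/2) dz along z(l, s) is the derivative in s of
(b + s p) exp(z^2/2), where b + s p is the derivative of z in l; that primitive
is real at s = 0, so the imaginary part of the integral does not depend on l. *)
Lemma gauss_integral_ray b p h : 2 * p ^+ 2 < h ^+ 2 ->
  Im_integral (gauss_ray b p h) = Im_integral (gauss_ray 0 0 h).
Proof.
move=> ph.
pose w l : R[i] := (l * p) +i* h.
pose f l := gauss_ray (l * b) (l * p) h.
pose P l (s : R) := ray (l * b) (l * p) h s * (b%:C + s%:C * p%:C) * w l + p%:C.
pose f' l (s : R) := P l s * cexp (half_sqr (ray (l * b) (l * p) h s)).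
pose G l (s : R) := (b%:C + s%:C * p%:C) * cexp (half_sqr (ray (l * b) (l * p) h s)).
have cl l : -1 < l < 4 / 3 -> `|l| <= 2 by rewrite ler_norml => /andP[]; lra.
have wB l : -1 < l < 4 / 3 -> normc (w l) <= 2 * `|p| + `|h|.
  move=> /cl lI; rewrite (le_trans (normc_leD _))//= lerD2r normrM.
  by rewrite ler_wpM2r.
have bpB : exp_bounded (normc b%:C + normc p%:C) 1 (fun s => b%:C + s%:C * p%:C).
  exact: exp_bounded_affine.
have rB l : -1 < l < 4 / 3 ->
    exp_bounded (2 * `|b| + (2 * `|p| + `|h|)) 1 (ray (l * b) (l * p) h).
  move=> lI; apply: exp_boundedW (exp_bounded_ray _ _ _) => //.
  by rewrite lerD ?wB// normcR normrM ler_wpM2r ?cl.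
have [C1 H1] : exists C, forall l, -1 < l < 4 / 3 -> dominated C (f l).
  apply: (@gauss_ray_dominated b p h (2 * `|p| + `|h|) 0 (fun l _ => w l)) => //.
  by move=> l lI; apply: exp_boundedW (exp_bounded_cst _) => //; exact: wB.
have [C2 H2] : exists C, forall l, -1 < l < 4 / 3 -> dominated C (f' l).
  pose A := (2 * `|b| + (2 * `|p| + `|h|)) * (normc b%:C + normc p%:C) * (2 * `|p| + `|h|).
  apply: (@gauss_ray_dominated b p h (A + normc p%:C) (1 + 1 + 0) P) => // l lI.
  apply: exp_boundedD; last first.
    by apply: exp_boundedW (exp_bounded_cst _) => //; lra.
  apply: exp_boundedM; first by apply: exp_boundedM => //; exact: rB.
  by apply: exp_boundedW (exp_bounded_cst _) => //; exact: wB.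
have [C3 H3] : exists C, forall l, -1 < l < 4 / 3 -> dominated C (G l).
  exact: (@gauss_ray_dominated b p h _ 1 (fun _ s => b%:C + s%:C * p%:C) ph (fun _ _ => bpB)).
have dE l : cderivable (fun s => cexp (half_sqr (ray (l * b) (l * p) h s))).
  exact/cderivable_cexp/cderivable_half_sqr/cderivable_ray.
have df l : cderivable (f l) by exact: (cderivableM (cderivable_cst _) (dE l)).
have df' l : cderivable (f' l).
  apply: cderivableM (dE l); apply: cderivableD; last exact: cderivable_cst.
  apply: cderivableM; last exact: cderivable_cst.
  by apply: cderivableM; [exact: cderivable_ray|exact: cderivable_affine].
have f'0 l : -1 < l < 4 / 3 -> Im_integral (f' l) = 0.
  move=> lI; rewrite (Im_integral_FTC (F := G l) _ (df' l) (H2 l lI) (H3 l lI)).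
  - rewrite /G /ray mul0r addr0 mul0r addr0 /half_sqr -!rmorphXn -rmorphM cexpR -rmorphM.
    by rewrite oppr0.
  - move=> s; apply: is_cderive_eq.
      apply: is_cderiveM; first exact: is_cderive_affine.
      exact/is_cderive_cexp/is_cderive_half_sqr/is_cderive_ray.
    by rewrite /f' /P /w; ring.
have dI l : -1 < l < 4 / 3 -> is_derive l 1 (fun l => Im_integral (f l)) 0.
  move=> lI; rewrite -(f'0 l lI).
  apply: (@is_derive_Im_integral _ C1 C2 f f' l (-1) (4 / 3) lI).
  - by move=> t tI; split; [exact: df|exact: H1].
  - move=> t s tI s0; rewrite /f /gauss_ray.
    have dw : is_cderive (fun t => (t * p) +i* h) t p%:C.
      rewrite (_ : (fun t => _) = (fun t => (0 +i* h) + t%:C * p%:C)); last first.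
        by apply/funext => r; apply: eq_ReIm; rewrite !(Re_add, Im_add, Re_mul, Im_mul) /=; ring.
      exact: is_cderive_affine.
    have dr : is_cderive (fun t => ray (t * b) (t * p) h s) t (b%:C + s%:C * p%:C).
      rewrite (_ : (fun t => _) =
          (fun t => (s%:C * (0 +i* h)) + t%:C * (b%:C + s%:C * p%:C))); last first.
        by apply/funext => r; apply: eq_ReIm; rewrite !(Re_add, Im_add, Re_mul, Im_mul) /=; ring.
      exact: is_cderive_affine.
    apply: is_cderive_eq.
      by apply: is_cderiveM; [exact: dw|exact/is_cderive_cexp/is_cderive_half_sqr/dr].
    by rewrite /f' /P /w; ring.
  - exact: H2.
have itv01 l : 0 <= l <= 1 -> -1 < l < 4 / 3 by case/andP; lra.
have [||t _] := @MVT_segment R (fun l => Im_integral (f l)) (fun=> 0) 0 1 ler01.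
- move=> t; rewrite in_itv/= => /andP[t0 t1]; apply/dI/itv01.
  by rewrite !ltW.
- apply: derivable_within_continuous => t; rewrite in_itv/= => tI.
  by have [] := dI t (itv01 t tI).
rewrite mul0r /f !mul1r !mul0r => /eqP.
by rewrite subr_eq0 => /eqP.
Qed.

(** Half of the total mass of the normal law of standard deviation 1/h. *)
Lemma gauss_integral_half h : 0 < h ->
  Im_integral (gauss_ray 0 0 h) = Num.sqrt (2 * pi) / 2.
Proof.
move=> h0.
have s0 : h^-1 != 0 by rewrite invr_eq0 gt_eqF.
have pk : normal_peak h^-1 = h / Num.sqrt (2 * pi).
  rewrite /normal_peak exprVn -mulrnAr -[pi *+ 2]mulr_natl sqrtrM ?invr_ge0 ?sqr_ge0//.
  by rewrite sqrtrV ?sqr_ge0// sqrtr_sqr gtr0_norm// invfM invrK.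
have q0 : Num.sqrt (2 * pi) != 0 :> R.
  by rewrite gt_eqF// sqrtr_gt0 mulr_gt0// pi_gt0.
have := @integral_normal_pdf R 0 h^-1.
rewrite ge0_symfun_integralT; last 3 first.
- by move=> s; exact: normal_pdf_ge0.
- exact: continuous_normal_pdf.
- by move=> s /=; rewrite !normal_pdfE// /normal_fun !subr0 sqrrN.
rewrite -set_itvcy => /(congr1 (@fine R)) /=.
set I := (\int[_]_(_ in _) _)%E.
have ifin : I \is a fin_num.
  apply: integrable_fin_num => //.
  exact: (integrableS measurableT _ _ (integrable_normal_pdf _ _)).
rewrite fineM// /= => I1.
have -> : Im_integral (gauss_ray 0 0 h) = Num.sqrt (2 * pi) * fine I.
  rewrite -[fine I]/(\int[mu]_(x in `[0, +oo[) normal_pdf 0 h^-1 x).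
  rewrite -RintegralZl//; last first.
    exact: (integrableS measurableT _ _ (integrable_normal_pdf _ _)).
  apply: eq_Rintegral => s _.
  rewrite normal_pdfE// pk /normal_fun subr0 /gauss_ray.
  rewrite Im_mul Re_cexp Im_cexp Re_half_sqr_ray.
  have -> : Im (half_sqr (ray 0 0 h s)) = 0.
    by rewrite /half_sqr Im_scale expr2 Im_mul /=; ring.
  rewrite cos0 sin0 /= !mulr0 mul0r add0r mulr1.
  have K (X : R) : Num.sqrt (2 * pi) * (h / Num.sqrt (2 * pi) * X) = h * X.
    by field.
  rewrite K; congr (_ * expR _).
  by field; rewrite gt_eqF.
by move/(congr1 (fun z => z / 2)): I1; rewrite mul1r => <-; field.
Qed.

Lemma hermite_integral0 x c p h : 0 < h -> 2 * p ^+ 2 < h ^+ 2 ->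
  hermite_integral 0 x c p h = Num.sqrt (2 * pi) / 2.
Proof.
move=> h0 ph; rewrite -(gauss_integral_half h0) -(gauss_integral_ray (c - x) ph).
by apply: eq_Im_integral => s _; rewrite /hermite_ray expr0 mul1r mulrC.
Qed.

(** Both sides satisfy the same recurrence in k with the same value at k = 0, and
the recurrence at k = 0 gives the value at k = 1. *)
Lemma hermite_integral_contour k x c p h c' p' h' :
  0 < h -> 2 * p ^+ 2 < h ^+ 2 -> 0 < h' -> 2 * p' ^+ 2 < h' ^+ 2 ->
  hermite_integral k x c p h = hermite_integral k x c' p' h'.
Proof.
move=> h0 ph h0' ph'.
have ph1 : p ^+ 2 < h ^+ 2 by have := sqr_ge0 p; lra.
have ph1' : p' ^+ 2 < h' ^+ 2 by have := sqr_ge0 p'; lra.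
suff [] : hermite_integral k x c p h = hermite_integral k x c' p' h' /\
  hermite_integral k.+1 x c p h = hermite_integral k.+1 x c' p' h' by [].
elim: k => [|k [IH1 IH2]].
  by rewrite !hermite_integral_rec// !mul0r !subr0 !hermite_integral0.
by split => //; rewrite hermite_integral_rec// [RHS]hermite_integral_rec//= IH1 IH2.
Qed.

End gauss_ray.

(** * Hermite polynomials as ray integrals *)

Section hermite_contour.
Variable R : realType.
Local Notation mu := (@lebesgue_measure R).
Local Notation pdf := (@normal_pdf R 0 1).

(** The density is the Radon-Nikodym derivative of the normal law, by uniqueness
of the latter. *)
Lemma ge0_integral_normal_prob (f : R -> \bar R) : (forall x, 0 <= f x)%E ->
  measurable_fun setT f ->
  (\int[normal_prob 0 1]_x f x = \int[mu]_x (f x * (pdf x)%:E))%E.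
Proof.
move=> f0 mf; pose dom := @normal_prob_dominates R 0 1.
rewrite -(Radon_Nikodym_SigmaFinite.change_of_variables dom)//.
have h1 := Radon_Nikodym_SigmaFinite.f_integrable dom.
have mpdf := @measurable_normal_pdf R 0 1.
apply: ae_eq_integral => //.
- apply: emeasurable_funM => //; exact: (measurable_int _ h1).
- by apply: emeasurable_funM => //; exact/measurable_EFinP.
- apply: ae_eqe_mul2l => /=.
  apply: integral_ae_eq => //=.
  + exact/measurable_EFinP.
  + by move=> E _ mE; rewrite -Radon_Nikodym_SigmaFinite.f_integral.
Qed.

(** The positive and negative parts are treated separately, each being a
nonnegative even function. *)
Lemma expectation_normal_even (g : R -> R) C : continuous g -> (forall z, g (- z) = g z) ->
  (forall z, 0 <= z -> `|g z * pdf z| <= C * expR (- z)) ->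
  fine 'E_(normal_prob 0 1)[g] = 2 * \int[mu]_(z in `[0%R, +oo[) (g z * pdf z).
Proof.
move=> cg eg gC; pose G z := g z * pdf z.
have cpdf : continuous pdf by apply: continuous_normal_pdf; rewrite oner_eq0.
have cG : continuous G by move=> z; apply: cvgM; [exact: cg|exact: cpdf].
have epdf z : pdf (- z) = pdf z.
  by rewrite !normal_pdfE ?oner_eq0// /normal_fun !subr0 sqrrN.
have eG z : G (- z) = G z by rewrite /G eg epdf.
have iG := integrable_decay cG gC.
have max_id z (a : R) : Num.max a 0 * pdf z = Num.max (a * pdf z) 0.
  by rewrite maxr_pMl ?normal_pdf_ge0// mul0r.
have half (H : R -> R) : continuous H -> (forall z, H (- z) = H z) ->
    (\int[mu]_z (Num.max (H z) 0)%:E =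
     2%:E * \int[mu]_(z in `[0%R, +oo[) (Num.max (H z) 0)%:E)%E.
  move=> cH eH; rewrite ge0_symfun_integralT.
  - by rewrite -set_itvcy.
  - by move=> z; rewrite le_max lexx orbT.
  - have -> : (fun z => Num.max (H z) 0) = (fun z => (H z + `|H z|) / 2).
      by apply/funext => z; rewrite maxr_absE addr0 subr0.
    move=> z; apply: cvgM; last exact: cvg_cst.
    by apply: cvgD; [exact: cH|apply: cvg_norm; exact: cH].
  - by move=> z /=; rewrite eH.
have pos (H : R -> R) : measurable_fun setT H ->
    (\int[normal_prob 0 1]_z (Num.max (H z) 0)%:E =
     \int[mu]_z (Num.max (H z * pdf z) 0)%:E)%E.
  move=> mH; rewrite ge0_integral_normal_prob.
  - by apply: eq_integral => z _; rewrite -EFinM max_id.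
  - by move=> z; rewrite lee_fin le_max lexx orbT.
  - apply/measurable_EFinP.
    exact: (@measurable_maxr _ _ _ setT H (fun=> 0)).
have mg : measurable_fun setT g by exact: continuous_measurable_fun.
rewrite expectation.unlock integralE.
have pE d (T : measurableType d) D (nu : {measure set T -> \bar R}) (H : T -> R) :
   ((\int[nu]_(z in D) ((fun y => (H y)%:E)^\+ z)) = \int[nu]_(z in D) (Num.max (H z) 0)%:E)%E.
  by apply: eq_integral => z _; rewrite funeposE /= EFin_max.
have nE d (T : measurableType d) D (nu : {measure set T -> \bar R}) (H : T -> R) :
   ((\int[nu]_(z in D) ((fun y => (H y)%:E)^\- z)) = \int[nu]_(z in D) (Num.max (- H z) 0)%:E)%E.
  by apply: eq_integral => z _; rewrite funenegE /= EFin_max.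
rewrite pE nE pos// (pos (fun z => - g z)); last exact: measurableT_comp.
rewrite (half G)// (half (fun z => - g z * pdf z)); last 2 first.
- by move=> z; apply: cvgM; [apply: cvgN; exact: cg|exact: cpdf].
- by move=> z; rewrite eg epdf.
rewrite /Rintegral [in RHS]integralE pE nE.
under [X in (_ - _ * X)%E]eq_integral do rewrite mulNr.
have fp : (\int[mu]_(z in `[0%R, +oo[) (Num.max (G z) 0)%:E)%E \is a fin_num.
  rewrite -pE; apply: integrable_fin_num => //; exact: integrable_funepos.
have fn : (\int[mu]_(z in `[0%R, +oo[) (Num.max (- G z) 0)%:E)%E \is a fin_num.
  rewrite -nE; apply: integrable_fin_num => //; exact: integrable_funeneg.
by rewrite -(fineK fp) -(fineK fn) /= mulrBr.
Qed.

(** The real part of (x + iZ)^k is even in Z, so the expectation is twice an integral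
over the half-line, which is the integral along the vertical ray from x. *)
Lemma hermiteE k (x c p h : R) : 0 < h -> 2 * p ^+ 2 < h ^+ 2 ->
  hermite k x = 2 / Num.sqrt (2 * pi) * hermite_integral k x c p h.
Proof.
move=> h0 ph.
have ph1 : 2 * (0 : R) ^+ 2 < 1 ^+ 2 by rewrite expr0n/= mulr0 expr1n.
have ph2 : (0 : R) ^+ 2 < 1 ^+ 2 by rewrite expr0n/= expr1n.
rewrite (hermite_integral_contour k x c x h0 ph ltr01 ph1).
have q0 : Num.sqrt (2 * pi) != 0 :> R.
  by rewrite gt_eqF// sqrtr_gt0 mulr_gt0// pi_gt0.
have rE (s : R) : ray x 0 1 s = x +i* s.
  by apply: eq_ReIm; rewrite /ray !(Re_add, Im_add, Re_mul, Im_mul) /=; ring.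
(* Multiplication by the direction i of the vertical ray turns the real part of
   (x + is)^k into an imaginary part. *)
have gE (s : R) : Re ((x +i* s) ^+ k) * pdf s =
    (Num.sqrt (2 * pi))^-1 * Im (hermite_ray k x x 0 1 s).
  rewrite normal_pdfE ?oner_eq0// /normal_peak expr1n mul1r mulr_natl.
  rewrite /hermite_ray rE subrr Im_mul [Im (0 +i* 1)]/= mulr1 [Re (0 +i* 1)]/= mulr0 addr0.
  rewrite Re_mul Re_cexp Im_cexp Re_half_sqr_ray.
  have -> : Im (half_sqr (ray 0 0 1 s)) = 0.
    by rewrite /half_sqr Im_scale expr2 Im_mul /=; ring.
  rewrite cos0 sin0 /= !mulr0 subr0 mulr1 mulrCA; congr (_ * (_ * _)).
  by rewrite /normal_fun; congr expR; rewrite subr0 expr1n; field.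
have [C HC] := hermite_ray_dominated k x x ph2.
rewrite /hermite /hermiteC /cexpectation /=.
rewrite (@expectation_normal_even _ ((Num.sqrt (2 * pi))^-1 * C)).
- rewrite -mulrA; congr (_ * _).
  rewrite /hermite_integral /Im_integral -RintegralZl//.
    by apply: eq_Rintegral => s _; rewrite gE.
  exact: integrable_Im (hermite_ray_cderivable _ _ _ _ _) HC.
- have -> : (fun w : R => Re ((x +i* w) ^+ k)) = (fun s => Im ('i * ray x 0 1 s ^+ k)).
    by apply/funext => s; rewrite rE Im_mul /= mul0r add0r mul1r.
  apply: cderivable_continuous_Im; apply: cderivableM; first exact: cderivable_cst.
  by apply: cderivableX; exact: cderivable_ray.
- move=> z; rewrite -[x +i* (- z)]/((x +i* z)^*%C) -rmorphXn /=.
  by case: (_ ^+ k).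
- move=> z z0; rewrite gE normrM ger0_norm ?invr_ge0// -mulrA ler_wpM2l ?invr_ge0//.
  exact: (dominated_Im HC).
Qed.

Lemma hermite0 (x : R) : hermite 0 x = 1.
Proof.
have ph : 2 * (0 : R) ^+ 2 < 1 ^+ 2 by rewrite expr0n/= mulr0 expr1n.
rewrite (hermiteE 0 x 0 ltr01 ph) hermite_integral0//.
by field; rewrite gt_eqF// sqrtr_gt0 mulr_gt0// pi_gt0.
Qed.

Lemma hermite_rec k (x : R) :
  hermite k.+1 x = x * hermite k x - k%:R * hermite k.-1 x.
Proof.
have ph : 2 * (0 : R) ^+ 2 < 1 ^+ 2 by rewrite expr0n/= mulr0 expr1n.
have ph2 : (0 : R) ^+ 2 < 1 ^+ 2 by rewrite expr0n/= expr1n.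
by rewrite !(hermiteE _ x 0 ltr01 ph) hermite_integral_rec//; ring.
Qed.

End hermite_contour.

(** * Christoffel-Darboux *)

Section christoffel_darboux.
Variable R : realType.
Implicit Types (x y : R) (n : nat).

Definition hermite_weight x : R :=
  Num.sqrt ((Num.sqrt (2 * pi))^-1 * expR (- (2^-1 * x ^+ 2))).

Lemma hermite_kernelE n x y : hermite_kernel n x y =
  hermite_weight x * hermite_weight y *
  \sum_(j < n) hermite j x * hermite j y / (j`!)%:R.
Proof.
rewrite /hermite_kernel big_distrr/=; apply: eq_bigr => j _.
rewrite /hermite_fun -!/(hermite_weight _).
have f0 : (0 : R) <= (j`!)%:R by rewrite ler0n.
rewrite -[X in _ / X](_ : Num.sqrt (j`!)%:R * Num.sqrt (j`!)%:R = _); last first.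
  by rewrite -expr2 sqr_sqrtr.
have s0 : Num.sqrt (j`!)%:R != 0 :> R by rewrite gt_eqF// sqrtr_gt0 ltr0n fact_gt0.
by field.
Qed.

Lemma christoffel_darboux n x y :
  (x - y) * (\sum_(j < n.+1) hermite j x * hermite j y / (j`!)%:R) =
  (hermite n.+1 x * hermite n y - hermite n x * hermite n.+1 y) / (n`!)%:R.
Proof.
elim: n => [|n IH].
  by rewrite big_ord1 /= !hermite_rec /= !hermite0 fact0; field.
rewrite big_ord_recr /= mulrDr IH (hermite_rec n.+1 x) (hermite_rec n.+1 y) /=.
have f0 : ((n`!)%:R : R) != 0 by rewrite pnatr_eq0 -lt0n fact_gt0.
have n0 : (n.+1%:R : R) != 0 by rewrite pnatr_eq0.
rewrite factS natrM; move: (n.+1%:R : R) n0 ((n`!)%:R : R) f0 => N n0 F f0.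
move: (hermite n.+1 x) (hermite n x) (hermite n.+1 y) (hermite n y) => a b c d.
by field; rewrite n0 f0.
Qed.

(** The confluent form of the previous identity, with the derivative of He_(n+1)
eliminated through He_(n+1)' = (n+1) He_n and the recurrence. *)
Lemma christoffel_darboux_diag n x :
  \sum_(j < n.+1) hermite j x * hermite j x / (j`!)%:R =
  (hermite n.+1 x ^+ 2 + n.+1%:R * hermite n x ^+ 2
   - x * hermite n.+1 x * hermite n x) / (n`!)%:R.
Proof.
elim: n => [|n IH].
  by rewrite big_ord1 /= !hermite_rec /= !hermite0 fact0; field.
rewrite big_ord_recr /= IH (hermite_rec n.+1 x) /=.
have f0 : ((n`!)%:R : R) != 0 by rewrite pnatr_eq0 -lt0n fact_gt0.
have n0 : (n.+1%:R : R) != 0 by rewrite pnatr_eq0.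
rewrite factS natrM -[n.+2%:R]natr1.
move: (n.+1%:R : R) n0 ((n`!)%:R : R) f0 => N n0 F f0.
move: (hermite n.+1 x) (hermite n x) => a b.
by field; rewrite n0 f0.
Qed.

End christoffel_darboux.

(** * The Airy function on a ray *)

Section airy_ray.
Variable R : realType.
Implicit Types (u x y : R) (k : nat).

Definition airy_dir : R[i] := 2^-1 +i* (Num.sqrt 3 / 2).
Local Notation w := airy_dir.

Lemma sqr_half_sqrt3 : (Num.sqrt 3 / 2 : R) ^+ 2 = 3 / 4.
Proof. by rewrite expr_div_n sqr_sqrtr//; lra. Qed.

Lemma cexp_pi3 : cexp (0 +i* (pi / 3)) = w.
Proof.
have p0 := pi_gt0 R.
have c0 : 0 < cos (pi / 3) :> R by apply: cos_gt0_pihalf; apply/andP; split; lra.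
have s0 : 0 < sin (pi / 3) :> R by apply: sin_gt0_pi; apply/andP; split; lra.
have cs := cos2Dsin2 (pi / 3 : R).
have cE : cos (pi / 3) = 2^-1 :> R.
  have : cos (pi / 3 + (pi / 3 + pi / 3)) = -1 :> R.
    by rewrite (_ : _ + _ = pi) ?cospi//; lra.
  rewrite !(cosD, sinD) => c3.
  (* The triple-angle formula: 4 c^3 - 3 c + 1 factors in this way. *)
  have : (cos (pi / 3) + 1) * (2 * cos (pi / 3) - 1) ^+ 2 = 0 :> R.
    move: c3 cs; set c := cos _; set s := sin _ => c3 cs.
    have s2 : s ^+ 2 = 1 - c ^+ 2 by rewrite -cs; ring.
    have -> : (c + 1) * (2 * c - 1) ^+ 2 = 4 * c ^+ 3 - 3 * c + 1 by ring.
    have <- : c * (c * c - s * s) - s * (s * c + c * s) + 1 = 0 by rewrite c3; ring.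
    have -> : c * (c * c - s * s) - s * (s * c + c * s) = c ^+ 3 - 3 * c * s ^+ 2 by ring.
    by rewrite s2; ring.
  move/eqP; rewrite mulf_eq0 sqrf_eq0 => /orP[/eqP|/eqP]; lra.
have sE : sin (pi / 3) = Num.sqrt 3 / 2 :> R.
  apply/eqP; rewrite -(eqrXn2 (n:=2)) ?divr_ge0 ?(ltW s0)//.
  by apply/eqP; rewrite sqr_half_sqrt3; move: cs; rewrite cE; lra.
by rewrite /cexp /= expR0 mul1r cE sE.
Qed.

Lemma airy_dir_sqr : w ^+ 2 = w - 1.
Proof.
have e := sqr_half_sqrt3.
apply: eq_ReIm; rewrite expr2 !(Re_mul, Im_mul, Re_add, Im_add, Re_opp, Im_opp) /=.
- by rewrite -!expr2 e; field.
- by field.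
Qed.

Lemma airy_dir_cube : w ^+ 3 = -1.
Proof. by rewrite exprS airy_dir_sqr mulrBr mulr1 -expr2 airy_dir_sqr; ring. Qed.

Definition airy_exponent u (s : R) : R[i] :=
  (- (s ^+ 3 / 3))%:C + (- u)%:C * (s%:C * w).

(** The integrand t^k exp(t^3/3 - ut) dt on the ray t = s w, where t^3 = - s^3. *)
Definition airy_ray k u (s : R) : R[i] :=
  (s%:C * w) ^+ k * w * cexp (airy_exponent u s).

Lemma airyE u : airy u = pi^-1 * Im_integral (airy_ray 0 u).
Proof.
rewrite /airy /airyC ray_integral_conj; last first.
  move=> z; rewrite -cexp_conj; congr cexp.
  have e3 : ((3%:R : R[i])^-1)^*%C = 3%:R^-1 by rewrite conjc_inv conjc_nat.
  rewrite rmorphB (rmorphM _ (z ^+ 3)) rmorphXn (rmorphM _ u%:C).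
  by rewrite -[in LHS]e3 -[in LHS](conjc_real u).
set I := ray_integral _ _.
have -> : Im_integral (airy_ray 0 u) = Im I.
  rewrite /I /ray_integral cexp_pi3 /cintegral.
  apply: eq_Rintegral => s _; congr Im.
  rewrite /airy_ray expr0 mul1r [RHS]mulrC; congr (_ * cexp _).
  rewrite /airy_exponent exprMn airy_dir_cube -rmorphXn /= !rmorphN /= rmorphM /=.
  rewrite fmorphV /= rmorph_nat; ring.
case: I => a b; have := pi_gt0 R; move: (pi : R) => P P0.
have -> : (0 +i* (2 * P))^-1 = 0 -i* (2 * P)^-1 :> R[i].
  have p0 : 2 * P != 0 by rewrite mulf_neq0// gt_eqF.
  apply: (mulfI (x := 0 +i* (2 * P))); last rewrite mulfV.
  - by apply/negP => /eqP [] /eqP; apply/negP.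
  - by apply: eq_ReIm; rewrite !(Re_mul, Im_mul) /=; [rewrite mulrN mulfV//|]; ring.
  - by apply/negP => /eqP [] /eqP; apply/negP.
by rewrite Re_mul /=; field; rewrite gt_eqF.
Qed.

Lemma cderivable_airy_exponent u : cderivable (airy_exponent u).
Proof.
apply: cderivableD; last first.
  apply: cderivableM; first exact: cderivable_cst.
  by apply: cderivableM; [exact: cderivable_id|exact: cderivable_cst].
have -> : (fun s : R => (- (s ^+ 3 / 3))%:C) = (fun s => (- 3^-1)%:C * s%:C ^+ 3).
  by apply/funext => s; rewrite -rmorphXn -rmorphM /= mulNr mulrC.
apply: cderivableM; first exact: cderivable_cst.
exact: (cderivableX 3 (@cderivable_id R)).
Qed.

Lemma cderivable_airy_ray k u : cderivable (airy_ray k u).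
Proof.
apply: cderivableM; last exact/cderivable_cexp/cderivable_airy_exponent.
apply: cderivableM; last exact: cderivable_cst.
apply: cderivableX; apply: cderivableM; first exact: cderivable_id.
exact: cderivable_cst.
Qed.

Lemma Re_airy_exponent u (s : R) :
  Re (airy_exponent u s) = - (s ^+ 3 / 3) - u / 2 * s.
Proof. by rewrite /airy_exponent !(Re_add, Re_mul, Im_mul) /=; field. Qed.

(** The cubic decay beats a quadratic one since
s^3/3 - s^2 + 4/3 = (s - 2)^2 (s + 1)/3 is nonnegative. *)
Lemma Re_airy_exponent_le (r u s : R) : `|u| <= r -> 0 <= s ->
  Re (airy_exponent u s) <= 4 / 3 + r / 2 * s - 1 * s ^+ 2.
Proof.
move=> ur s0; rewrite Re_airy_exponent.
have h1 : 0 <= (s - 2) ^+ 2 * (s + 1) by rewrite mulr_ge0 ?sqr_ge0//; lra.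
have h2 : - u / 2 * s <= r / 2 * s.
  by rewrite ler_wpM2r// ler_pM2r// (le_trans (ler_norm _))// normrN.
have e : (s - 2) ^+ 2 * (s + 1) = s ^+ 3 - 3 * s ^+ 2 + 4 by ring.
by rewrite e in h1; lra.
Qed.

Lemma airy_dominated k (r : R) : exists C, forall u, `|u| <= r ->
  dominated C (airy_ray k u).
Proof.
have wB : exp_bounded (normc (0 : R[i]) + normc w) 1 (fun s : R => 0 + s%:C * w).
  exact: exp_bounded_affine.
have wkB := exp_boundedM (exp_boundedX k wB) (exp_bounded_cst w).
eexists => u ur.
have := @gauss_dominated _ _ _ (4 / 3) (r / 2) 1 _ (airy_exponent u) ltr01 wkB.
have eE : (fun s : R => (0 + s%:C * w) ^+ k * w * cexp (airy_exponent u s)) = airy_ray k u.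
  by apply/funext => s; rewrite add0r.
by rewrite eE; apply => s; exact: Re_airy_exponent_le.
Qed.

Lemma is_derive_airy_integral k u :
  is_derive u 1 (fun u => Im_integral (airy_ray k u)) (- Im_integral (airy_ray k.+1 u)).
Proof.
have [C1 H1] := airy_dominated k (`|u| + 1).
have [C2 H2] := airy_dominated k.+1 (`|u| + 1).
have ub t : u - 1 < t < u + 1 -> `|t| <= `|u| + 1.
  move=> tI; rewrite -{1}(subrK u t) (le_trans (ler_normD _ _))// addrC lerD2l.
  by rewrite ler_norml; lra.
have uI : u - 1 < u < u + 1 by lra.
have -> : - Im_integral (airy_ray k.+1 u) =
    Im_integral (fun s => (-1)%:C * airy_ray k.+1 u s).
  rewrite (Im_integralZ _ (@cderivable_airy_ray _ _) (H2 u (ub u uI))).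
  by rewrite mulN1r.
apply: (is_derive_Im_integral (C := C1) (C' := `|-1| * C2) (f := fun u => airy_ray k u)
  (f' := fun u s => (-1)%:C * airy_ray k.+1 u s) uI).
- by move=> t tI; split; [exact: cderivable_airy_ray|exact/H1/ub].
- move=> t s tI s0; rewrite /airy_ray /airy_exponent.
  have de : is_cderive (fun t => (- (s ^+ 3 / 3))%:C + (- t)%:C * (s%:C * w)) t
      (- (s%:C * w)).
    rewrite (_ : (fun t => _) =
        (fun t => (- (s ^+ 3 / 3))%:C + t%:C * (- (s%:C * w)))).
      exact: is_cderive_affine.
    by apply/funext => r; rewrite !rmorphN mulrN mulNr.
  apply: is_cderive_eq.
    by apply: is_cderiveM; [exact: is_cderive_cst|exact: (is_cderive_cexp de)].
  have -> : (-1)%:C = -1 :> R[i] by rewrite rmorphN rmorph1.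
  by rewrite (exprS _ k); ring.
- by move=> t tI; apply: dominatedZ; exact/H2/ub.
Qed.

(** The derivative of exp(t^3/3 - ut) is (t^2 - u) exp(t^3/3 - ut), and its
primitive is 1 at t = 0. *)
Lemma airy_integral_ode u :
  Im_integral (airy_ray 2 u) = u * Im_integral (airy_ray 0 u).
Proof.
have [C0 H0] := airy_dominated 0 `|u|.
have [C2 H2] := airy_dominated 2 `|u|.
pose F (s : R) := cexp (airy_exponent u s).
pose f (s : R) := airy_ray 2 u s + (- u)%:C * airy_ray 0 u s.
have d0 := @cderivable_airy_ray 0 u; have d2 := @cderivable_airy_ray 2 u.
have du : cderivable (fun s => (- u)%:C * airy_ray 0 u s).
  by apply: cderivableM => //; exact: cderivable_cst.
have {}H0 := H0 u (lexx _); have {}H2 := H2 u (lexx _).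
have Hu := dominatedZ (- u) H0.
have wE : normc w = 1.
  rewrite /= sqr_half_sqrt3 (_ : _ + _ = 1) ?sqrtr1//.
  by field.
have FC : dominated C0 F.
  by move=> s s0; have := H0 s s0; rewrite /airy_ray expr0 mul1r normcM wE mul1r.
have fE : Im_integral f = 0.
  rewrite (Im_integral_FTC (F := F) _ (cderivableD d2 du) (dominatedD H2 Hu) FC).
  - have e0 : airy_exponent u 0 = 0.
      by rewrite /airy_exponent expr0n /= mul0r oppr0 rmorph0 mul0r mulr0 addr0.
    by rewrite /F e0 cexp0 oppr0.
  - move=> s; rewrite /F /f /airy_ray /airy_exponent.
    have dc : is_cderive (fun s : R => (- (s ^+ 3 / 3))%:C) s (- s%:C ^+ 2).
      have -> : (fun s : R => (- (s ^+ 3 / 3))%:C) = (fun s => (- 3^-1)%:C * s%:C ^+ 3).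
        by apply/funext => x; rewrite -rmorphXn -rmorphM /= mulNr mulrC.
      apply: is_cderive_eq.
        apply: is_cderiveM; first exact: is_cderive_cst.
        exact: (is_cderiveX 3 (is_cderive_id s)).
      by rewrite mul0r add0r mulr1 mulrA rmorphN fmorphV /= rmorph_nat; field.
    apply: is_cderive_eq.
      apply: is_cderive_cexp; apply: (is_cderiveD dc).
      apply: is_cderiveM; first exact: is_cderive_cst.
      by apply: is_cderiveM; [exact: is_cderive_id|exact: is_cderive_cst].
    have -> : (s%:C * w) ^+ 2 * w = - s%:C ^+ 2.
      by rewrite exprMn -mulrA -exprSr airy_dir_cube mulrN1.
    by rewrite expr0; ring.
have := Im_integralD d2 du H2 Hu.
by rewrite -/f fE (Im_integralZ _ d0 H0); lra.
Qed.

Definition airy' u := - (pi^-1 * Im_integral (airy_ray 1 u)).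

Lemma is_derive_airy u : is_derive u 1 (@airy R) (airy' u).
Proof.
have -> : @airy R = (fun u => (pi^-1 *: Im_integral (airy_ray 0 u) : R)).
  by apply/funext => x; rewrite airyE.
apply: is_derive_eq; first exact: is_deriveZ (is_derive_airy_integral 0 u).
by rewrite /airy' scalerN.
Qed.

Lemma is_derive_airy' u : is_derive u 1 airy' (u * airy u).
Proof.
have -> : airy' = (fun u => ((- pi^-1) *: Im_integral (airy_ray 1 u) : R)).
  by apply/funext => x; rewrite /airy' /GRing.scale /= mulNr.
apply: is_derive_eq; first exact: is_deriveZ (is_derive_airy_integral 1 u).
by rewrite airy_integral_ode airyE /GRing.scale /=; ring.
Qed.

End airy_ray.

(** * The Airy kernel on the diagonal *)

Section airy_kernel_diag.
Variable R : realType.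
Implicit Types (u x y : R).

Lemma derive1_airy u : (@airy R)^`()%classic u = airy' u.
Proof. by rewrite derive1E; have [_ ->] := is_derive_airy u. Qed.

Lemma continuous_airy : continuous (@airy R).
Proof. exact: derivable_continuous (@is_derive_airy R). Qed.

Lemma continuous_airy' : continuous (@airy' R).
Proof. exact: derivable_continuous (@is_derive_airy' R). Qed.

Lemma airy_kernel_offdiag u x : u != x -> airy_kernel u x =
  (airy u * airy' x - airy' u * airy x) / (u - x).
Proof.
by move=> /negbTE ux; rewrite /airy_kernel ux /airy_quotient !derive1_airy.
Qed.

(** The numerator, as a function of x, vanishes at x = y and has derivative
Ai'(x) Ai'(y) - x Ai(x) Ai(y). *)
Lemma airy_quotient_mean x y : x != y -> exists c,
  (Num.min x y <= c <= Num.max x y) /\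
  airy_quotient x y = airy' c * airy' y - c * airy c * airy y.
Proof.
move=> xy; pose f t := airy t * airy' y - airy' t * airy y.
pose df t := airy' t * airy' y - t * airy t * airy y.
have dfE (t : R) : is_derive t 1 f (df t).
  have d1 := is_derive_airy t; have d2 := is_derive_airy' t.
  have -> : f = (airy' y *: @airy R) - (airy y *: @airy' R).
    apply/funext => z; transitivity (airy' y * airy z - airy y * airy' z) => //.
    by rewrite /f; move: (airy z) (airy' z) (airy y) (airy' y) => *; ring.
  apply: is_derive_eq; rewrite /df /GRing.scale /=.
  by move: (airy t) (airy' t) (airy y) (airy' y) => *; ring.
have fy : f y = 0 by rewrite /f mulrC subrr.
have qE : airy_quotient x y = f x / (x - y) by rewrite /airy_quotient !derive1_airy.
have cf a b : {within `[a, b], continuous f}.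
  exact/continuous_subspaceT/(derivable_continuous dfE).
have xy0 : x - y != 0 by rewrite subr_eq0.
case: (ltgtP x y) xy => // [lt|lt] _.
- have [c + fE] := MVT lt (fun t _ => dfE t) (cf x y).
  rewrite in_itv/= => /andP[c1 c2]; exists c; split; first by rewrite !ltW.
  rewrite qE -/(df c); apply: (mulIf xy0); rewrite mulfVK//.
  by rewrite -[LHS]subr0 -fy -opprB fE -mulrN opprB.
- have [c + fE] := MVT lt (fun t _ => dfE t) (cf y x).
  rewrite in_itv/= => /andP[c1 c2]; exists c; split; first by rewrite !ltW.
  rewrite qE -/(df c); apply: (mulIf xy0); rewrite mulfVK//.
  by rewrite -[LHS]subr0 -fy fE.
Qed.

Lemma airy_kernel_diag u : airy_kernel u u = airy' u ^+ 2 - u * airy u ^+ 2.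
Proof.
rewrite /airy_kernel eqxx; apply/cvg_lim => //.
  apply: within_nbhs_proper => B /nbhs_ballP[e /= e0 uB].
  exists (u + e / 2, u); split => /=.
    by rewrite -subr_eq0 addrAC subrr add0r gt_eqF// divr_gt0.
  apply: uB; split => /=; last exact: ballxx.
  rewrite /ball /= opprD addrA subrr sub0r normrN ger0_norm ?divr_ge0 ?ltW//.
  by rewrite ltr_pdivrMr// ltr_pMr// ltr1n.
pose psi (p : R * R) := airy' p.1 * airy' p.2 - p.1 * airy p.1 * airy p.2.
have psic : psi p @[p --> (u, u)] --> psi (u, u).
  have c1 (g : R -> R) : continuous g -> g p.1 @[p --> (u, u)] --> g u.
    by move=> cg; apply: (cvg_comp fst g) (cg u); exact: cvg_fst.
  have c2 (g : R -> R) : continuous g -> g p.2 @[p --> (u, u)] --> g u.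
    by move=> cg; apply: (cvg_comp snd g) (cg u); exact: cvg_snd.
  apply: cvgB; apply: cvgM; [exact/c1/continuous_airy'|exact/c2/continuous_airy'| |].
    by apply: cvgM; [exact: cvg_fst|exact/c1/continuous_airy].
  exact/c2/continuous_airy.
have -> : airy' u ^+ 2 - u * airy u ^+ 2 = psi (u, u) by rewrite /psi /=; ring.
apply/cvgrPdist_le => e e0.
move/cvgrPdist_le : psic => /(_ e e0)/nbhs_ballP[d /= d0 H].
apply/nbhs_ballP; exists d => //= -[x y] [/= xd yd] xy.
have [c [cI ->]] := airy_quotient_mean xy.
apply: (H (c, y)); split => //=.
move: xd yd; rewrite /ball /= !ltr_norml => /andP[? ?] /andP[? ?].
by move: cI; case: (leP x y) => _ /andP[? ?]; apply/andP; split; lra.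
Qed.

End airy_kernel_diag.

(** * The double saddle point *)

Section saddle.
Variable R : realType.
Implicit Types (t s u m : R) (z : R[i]).
Local Notation w := (airy_dir R).

(** In the estimate of the saddle below the terms up to second order cancel exactly,
so that the bound 1 + t would not do. *)
Lemma expR_ge1Dx2 t : 0 <= t -> 1 + t + t ^+ 2 / 2 <= expR t.
Proof.
rewrite le_eqVlt => /predU1P[<-|t0]; first by rewrite expR0 expr0n/=; lra.
pose f (x : R) := expR x - (1 + x + x ^+ 2 / 2).
have df (x : R) : is_derive x 1 f (expR x - (1 + x)).
  have -> : f = (@expR R) - (cst 1 + id + (2^-1 \*: (fun x : R => x ^+ 2))).
    by apply/funext => y; rewrite /f; congr (_ - (_ + _)); rewrite mulrC.
  by apply: is_derive_eq; rewrite /GRing.scale /=; field.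
have [c _ fE] := MVT t0 (fun x _ => df x)
  (continuous_subspaceT (derivable_continuous df)).
have : 0 <= f t - f 0.
  by rewrite fE subr0 mulr_ge0 ?(ltW t0)// subr_ge0 expR_ge1Dx.
by rewrite /f expR0 expr0n /=; lra.
Qed.

(** Both sides are compared with (1 + |z - 1|)^n - 1, by telescoping z^n - 1. *)
Lemma normc_expr_sub1 z n : normc (z ^+ n - 1) <= expR (n%:R * normc (z - 1)) - 1.
Proof.
set d := normc (z - 1); have d0 : 0 <= d := normc_ge0 _.
apply: (le_trans (y := (1 + d) ^+ n - 1)); last first.
  rewrite lerD2r expRM_natl lerXn2r ?nnegrE ?expR_ge0 ?expR_ge1Dx//; lra.
have zn j : normc (z ^+ j) <= (1 + d) ^+ j.
  rewrite normcX lerXn2r ?nnegrE ?normc_ge0//; first by lra.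
  by rewrite -[z in normc z](subrK 1 z) addrC (le_trans (normcD _ _))// normc1.
elim: n => [|n IH]; first by rewrite !expr0 !subrr normc0.
have -> : z ^+ n.+1 - 1 = z ^+ n * (z - 1) + (z ^+ n - 1) by rewrite exprSr; ring.
rewrite (le_trans (normcD _ _))// normcM -/d exprSr.
have : normc (z ^+ n) * d <= (1 + d) ^+ n * d by rewrite ler_wpM2r.
by move: IH; lra.
Qed.

(** One of the n equal factors of the rescaled Hermite integrand. Its logarithm is
z^3/3 + O(z^4): the first two derivatives of the phase vanish at z = 0. *)
Definition saddle z : R[i] := (1 + z) * cexp (- z + half_sqr z).

Lemma normc_1Dray t : 0 <= t -> normc (1 + t%:C * w) ^+ 2 = 1 + t + t ^+ 2.
Proof.
move=> t0; have e := @sqr_half_sqrt3 R.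
have -> : 1 + t%:C * w = (1 + t / 2) +i* (t * (Num.sqrt 3 / 2)).
  by apply: eq_ReIm; rewrite !(Re_add, Im_add, Re_mul, Im_mul) /=; field.
by rewrite /= sqr_sqrtr ?addr_ge0 ?sqr_ge0// exprMn e; field.
Qed.

Lemma Re_saddle_exponent t :
  Re (- (t%:C * w) + half_sqr (t%:C * w)) = - (t / 2) - t ^+ 2 / 4.
Proof.
have e := @sqr_half_sqrt3 R.
rewrite Re_add Re_opp /half_sqr Re_scale expr2 !(Re_mul, Im_mul) /=.
move: (Num.sqrt 3 / 2) e => k e.
have : t ^+ 2 * k ^+ 2 = t ^+ 2 * (3 / 4) by rewrite e.
by lra.
Qed.

(** Squared, the claim is 1 + t + t^2 <= exp(x) with
x = t + t^2/2 - t^3/(2 (1 + t)) = t (2 + 3 t)/(2 + 2 t), and 1 + x + x^2/2 exceeds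
1 + t + t^2 by t^4/(8 (1 + t)^2). *)
Lemma normc_saddle t : 0 <= t ->
  normc (saddle (t%:C * w)) <= expR (- (t ^+ 3 / (4 * (1 + t)))).
Proof.
move=> t0; rewrite -(@ler_pXn2r _ 2) ?nnegrE ?normc_ge0 ?expR_ge0//.
rewrite normcM exprMn normc_1Dray// normc_cexp Re_saddle_exponent -!expRM_natl.
pose x := t * (2 + 3 * t) / (2 + 2 * t).
have x0 : 0 <= x by rewrite divr_ge0 ?mulr_ge0//; lra.
have t1 : 2 + 2 * t != 0 by rewrite gt_eqF//; lra.
have t2 : 1 + t != 0 by rewrite gt_eqF//; lra.
have h : 1 + t + t ^+ 2 <= expR x.
  apply: le_trans (expR_ge1Dx2 x0).
  have -> : 1 + x + x ^+ 2 / 2 = 1 + t + t ^+ 2 + t ^+ 4 / (8 * (1 + t) ^+ 2).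
    by rewrite /x; field; rewrite t1 t2.
  by rewrite lerDl divr_ge0 ?mulr_ge0 ?exprn_ge0//; lra.
apply: le_trans (ler_wpM2r (expR_ge0 _) h) _; rewrite -expRD ler_expR le_eqVlt.
by apply/orP; left; apply/eqP; rewrite /x; field; rewrite t1 t2.
Qed.

(** The saddle divided by its limiting behaviour exp(y^3/3), at y = t w where
y^3 = - t^3. *)
Definition saddle_ratio t : R[i] :=
  (1 + t%:C * w) * cexp (- (t%:C * w) + half_sqr (t%:C * w) + (3^-1)%:C * t%:C ^+ 3).

Lemma saddle_ratioE t :
  saddle (t%:C * w) = saddle_ratio t * cexp (- (t ^+ 3 / 3))%:C.
Proof.
rewrite /saddle /saddle_ratio -mulrA -cexpD; congr (_ * cexp _).
rewrite rmorphN rmorphM rmorphXn /=; ring.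
Qed.

Lemma is_cderive_saddle_ratio t : is_cderive saddle_ratio t
  (t%:C ^+ 3 * w * cexp (- (t%:C * w) + half_sqr (t%:C * w) + (3^-1)%:C * t%:C ^+ 3)).
Proof.
have dz : is_cderive (fun t => t%:C * w) t w.
  rewrite (_ : (fun t => t%:C * w) = (fun t => 0 + t%:C * w)).
    exact: is_cderive_affine.
  by apply/funext => r; rewrite add0r.
apply: is_cderive_eq.
  apply: is_cderiveM; first exact: is_cderive_affine.
  apply: is_cderive_cexp; apply: is_cderiveD.
    apply: is_cderiveD; last exact: is_cderive_half_sqr dz.
    rewrite (_ : (fun s => - (s%:C * w)) = (fun s => 0 + s%:C * (- w))).
      exact: is_cderive_affine.
    by apply/funext => r; rewrite add0r mulrN.
  apply: is_cderiveM; first exact: is_cderive_cst.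
  exact: (is_cderiveX 3 (is_cderive_id t)).
have h3 : (3^-1)%:C * 3 = 1 :> R[i] by rewrite fmorphV rmorph_nat mulVf.
set E := cexp _; rewrite mul0r add0r mulr1 /=.
have -> : (3^-1)%:C * (3%:R * t%:C ^+ 2) = t%:C ^+ 2 :> R[i] by rewrite mulrA h3 mul1r.
have w3 := airy_dir_cube R; have w2 := airy_dir_sqr R.
transitivity (E * (w + (1 + t%:C * w) * (- w + t%:C * w ^+ 2 + t%:C ^+ 2))).
  by rewrite expr2; ring.
have -> : w + (1 + t%:C * w) * (- w + t%:C * w ^+ 2 + t%:C ^+ 2) =
  t%:C ^+ 2 * (1 + w ^+ 3) + t%:C ^+ 3 * w by ring.
by rewrite w3 subrr mulr0 add0r mulrC.
Qed.

(** With y = t w the derivative in t is t^3 w times an exponential of modulus at most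
1 on [0, 1]: the first three orders cancel. *)
Lemma saddle_ratio_sub1 t : 0 <= t <= 1 -> normc (saddle_ratio t - 1) <= 2 * t ^+ 4.
Proof.
move=> /andP[t0 t1].
have r0 : saddle_ratio 0 = 1.
  rewrite /saddle_ratio /half_sqr !mul0r addr0 mul1r expr0n /= mulr0 oppr0 !add0r.
  by rewrite expr0n mulr0 cexp0.
pose d x : R[i] := x%:C ^+ 3 * w *
  cexp (- (x%:C * w) + half_sqr (x%:C * w) + (3^-1)%:C * x%:C ^+ 3).
have nw : normc w = 1 by rewrite /= sqr_half_sqrt3 (_ : _ + _ = 1) ?sqrtr1//; field.
have dle x : 0 <= x <= t -> normc (d x) <= t ^+ 3.
  move=> /andP[x0 xt]; rewrite /d 2!normcM nw mulr1 normcX normcR ger0_norm//.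
  rewrite normc_cexp Re_add Re_saddle_exponent Re_scale -rmorphXn /=.
  rewrite -[leRHS]mulr1; apply: ler_pM; rewrite ?exprn_ge0 ?expR_ge0//.
    by rewrite lerXn2r ?nnegrE//; lra.
  rewrite expR_le1; have x1 : x <= 1 by lra.
  have : x ^+ 3 <= x ^+ 2 by rewrite exprSr ler_piMr ?sqr_ge0.
  have : x ^+ 2 <= x by rewrite expr2 ler_piMr.
  by lra.
have part (f df : R -> R) : f 0 = 0 -> (forall x : R, is_derive x 1 f (df x)) ->
    (forall x, 0 <= x <= t -> `|df x| <= t ^+ 3) -> `|f t| <= t ^+ 4.
  move=> f0 fd dft.
  have [c + fE] := MVT_segment t0 (fun x _ => fd x)
    (continuous_subspaceT (derivable_continuous fd)).
  rewrite in_itv/= => cI; rewrite -[f t]subr0 -f0 fE subr0 normrM exprSr.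
  by rewrite [`|t|]ger0_norm// ler_wpM2r// dft.
have dr (x : R) : is_cderive (fun x => saddle_ratio x + -1) x (d x + 0).
  by apply: is_cderiveD; [exact: is_cderive_saddle_ratio|exact: is_cderive_cst].
rewrite (le_trans (normc_leD _))// mulr_natl mulr2n lerD//.
- apply: (part (fun x => Re (saddle_ratio x + -1)) (fun x => Re (d x + 0))).
  + by rewrite r0 subrr.
  + by move=> x; have [] := dr x.
  + by move=> x xt; rewrite addr0 (le_trans (normc_Re _))// dle.
- apply: (part (fun x => Im (saddle_ratio x + -1)) (fun x => Im (d x + 0))).
  + by rewrite r0 subrr.
  + by move=> x; have [] := dr x.
  + by move=> x xt; rewrite addr0 (le_trans (normc_Im _))// dle.
Qed.

(** At t = s/m one has n t^3 = s^3, and the error n t^4 is s^4/m. *)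
Lemma saddle_power_sub m n s : 0 < m -> m ^+ 3 = n%:R -> 0 <= s <= m ->
  normc (saddle ((s / m)%:C * w) ^+ n - cexp (- (s ^+ 3 / 3))%:C) <=
  expR (2 * s ^+ 4 / m) - 1.
Proof.
move=> m0 mn /andP[s0 sm].
have t01 : 0 <= s / m <= 1
  by apply/andP; split; [rewrite divr_ge0// ltW|rewrite ler_pdivrMr// mul1r].
have m1 : m != 0 by rewrite gt_eqF.
have n0 : (n%:R : R) != 0 by rewrite -mn expf_neq0.
rewrite saddle_ratioE exprMn -cexpMn.
have -> : n%:R * (- ((s / m) ^+ 3 / 3))%:C = (- (s ^+ 3 / 3))%:C :> R[i].
  rewrite -(rmorph_nat (real_complex R)) -rmorphM; congr real_complex_def.
  by rewrite -mn; field.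
set r := saddle_ratio _; set E := cexp _.
have -> : r ^+ n * E - E = (r ^+ n - 1) * E by rewrite mulrBl mul1r.
have E1 : normc E <= 1.
  by rewrite normc_cexp expR_le1 /= oppr_le0 divr_ge0 ?exprn_ge0.
rewrite normcM (le_trans (y := normc (r ^+ n - 1) * 1))//.
  by rewrite ler_wpM2l ?normc_ge0.
rewrite mulr1 (le_trans (normc_expr_sub1 _ _))// lerD2r ler_expR.
apply: (le_trans (ler_wpM2l (ler0n _ _) (saddle_ratio_sub1 t01))).
by rewrite -mn le_eqVlt; apply/orP; left; apply/eqP; field.
Qed.

(** The bound of the saddle at t = s/m gives n t^3/(1 + t) = s^3/(1 + s/m), which
dominates s^2 - s uniformly in m >= 1. *)
Lemma normc_saddle_power m n s : 1 <= m -> m ^+ 3 = n%:R -> 0 <= s ->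
  normc (saddle ((s / m)%:C * w) ^+ n) <= expR (s / 4 - s ^+ 2 / 4).
Proof.
move=> m1 mn s0; have m0 : 0 < m by lra.
have t0 : 0 <= s / m by rewrite divr_ge0// ltW.
rewrite normcX; apply: (le_trans (lerXn2r n _ _ (normc_saddle t0))).
- by rewrite nnegrE normc_ge0.
- by rewrite nnegrE expR_ge0.
rewrite -expRM_natl ler_expR -mn.
have ms : 0 < m + s by lra.
have -> : m ^+ 3 * - ((s / m) ^+ 3 / (4 * (1 + s / m))) = - (s ^+ 3 * m / (m + s)) / 4.
  have : m + s != 0 by rewrite gt_eqF.
  by move=> ?; field; rewrite !gt_eqF//=.
suff : s ^+ 2 - s <= s ^+ 3 * m / (m + s) by lra.
rewrite ler_pdivlMr//.
have : 0 <= s ^+ 2 * (m - 1) * s by rewrite !mulr_ge0 ?sqr_ge0//; lra.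
rewrite !exprS expr0; nra.
Qed.

End saddle.

(** * Convergence to the Airy integrals *)

Section airy_limit.
Variable R : realType.
Implicit Types (s u m q : R) (n : nat).
Local Notation w := (airy_dir R).

(** The rescaled integrand of He_n, which tends to the integrand of the Airy function. *)
Definition pre_airy m n u s : R[i] :=
  saddle ((s / m)%:C * w) ^+ n * cexp ((- u)%:C * (s%:C * w)) * w.

(** The rescaled integrand of m (He_(n+1) - sqrt(n+1) He_n), which tends to the
integrand of - Ai'. The quotient saddle(y)^(n+1)/(1 + y) is written without
a division. *)
Definition pre_airy1 m n u s : R[i] :=
  s%:C * w * (saddle ((s / m)%:C * w) ^+ n *
    cexp (- ((s / m)%:C * w) + half_sqr ((s / m)%:C * w))
    * cexp ((- u)%:C * (s%:C * w)) * w).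

Lemma normc_airy_dir : normc w = 1.
Proof.
by rewrite /= sqr_half_sqrt3 (_ : _ + _ = 1) ?sqrtr1//; field.
Qed.

Lemma cderivable_scale_ray m : cderivable (fun s => (s / m)%:C * w).
Proof.
rewrite (_ : (fun s => _) = (fun s => 0 + s%:C * ((m^-1)%:C * w))).
  exact: cderivable_affine.
by apply/funext => s; rewrite add0r mulrA -rmorphM.
Qed.

Lemma cderivable_oppray (f : R -> R[i]) : cderivable f -> cderivable (fun s => - f s).
Proof.
move=> df; rewrite (_ : (fun s => _) = (fun s => -1 * f s)).
  by apply: cderivableM => //; exact: cderivable_cst.
by apply/funext => s; rewrite mulN1r.
Qed.

Lemma cderivable_saddle_exp m :
  cderivable (fun s => cexp (- ((s / m)%:C * w) + half_sqr ((s / m)%:C * w))).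
Proof.
have dz := cderivable_scale_ray m.
apply: cderivable_cexp; apply: cderivableD; first exact: cderivable_oppray.
exact: cderivable_half_sqr.
Qed.

Lemma cderivable_saddle m : cderivable (fun s => saddle ((s / m)%:C * w)).
Proof.
apply: cderivableM (cderivable_saddle_exp m).
by apply: cderivableD; [exact: cderivable_cst|exact: cderivable_scale_ray].
Qed.

Lemma cderivable_wave u : cderivable (fun s => cexp ((- u)%:C * (s%:C * w)) * w).
Proof.
apply: cderivableM; last exact: cderivable_cst.
apply: cderivable_cexp; apply: cderivableM; first exact: cderivable_cst.
by apply: cderivableM; [exact: cderivable_id|exact: cderivable_cst].
Qed.

Lemma cderivable_pre_airy m n u : cderivable (pre_airy m n u).
Proof.
rewrite (_ : pre_airy m n u = fun s => saddle ((s / m)%:C * w) ^+ n *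
  (cexp ((- u)%:C * (s%:C * w)) * w)).
  by apply: cderivableM (cderivable_wave u); exact: cderivableX (cderivable_saddle m).
by apply/funext => s; rewrite /pre_airy -mulrA.
Qed.

Lemma cderivable_pre_airy1 m n u : cderivable (pre_airy1 m n u).
Proof.
apply: cderivableM.
  by apply: cderivableM; [exact: cderivable_id|exact: cderivable_cst].
rewrite (_ : (fun s => _ ) = fun s => saddle ((s / m)%:C * w) ^+ n *
  cexp (- ((s / m)%:C * w) + half_sqr ((s / m)%:C * w)) *
  (cexp ((- u)%:C * (s%:C * w)) * w)).
  apply: cderivableM (cderivable_wave u).
  apply: cderivableM (cderivable_saddle_exp m).
  exact: cderivableX (cderivable_saddle m).
by apply/funext => s; rewrite -[LHS]mulrA.
Qed.

Lemma pre_airy_sub m n u s :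
  pre_airy m n.+1 u s - saddle ((s / m)%:C * w) ^+ n *
    cexp (- ((s / m)%:C * w) + half_sqr ((s / m)%:C * w))
    * cexp ((- u)%:C * (s%:C * w)) * w = (m^-1)%:C * pre_airy1 m n u s.
Proof.
rewrite /pre_airy /pre_airy1 exprSr.
set A := saddle _ ^+ n; rewrite /saddle; set E := cexp (- _ + _); set c := cexp (_ * _).
have -> : (s / m)%:C = (m^-1)%:C * s%:C :> R[i] by rewrite -rmorphM mulrC.
ring.
Qed.

Lemma normc_wave u s : 0 <= s ->
  normc (cexp ((- u)%:C * (s%:C * w)) * w) <= expR (`|u| / 2 * s).
Proof.
move=> s0; rewrite normcM normc_airy_dir mulr1 normc_cexp ler_expR Re_scale Re_scale /=.
have : - u * s <= `|u| * s by rewrite ler_wpM2r// (le_trans (ler_norm _))// normrN.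
by lra.
Qed.

(** A Gaussian majorant of the integrands for all parameters |u| <= r at once,
in the quadratic form that the domination lemma expects. *)
Definition envelope (r s : R) : R[i] := (0 + (4^-1 + r / 2) * s - 4^-1 * s ^+ 2)%:C.

Lemma envelope_dominated (r : R) : exists C,
  dominated C (fun s => cexp (envelope r s)) /\
  dominated C (fun s => (0 + s%:C * w) * cexp (envelope r s)).
Proof.
have d0 : 0 < 4^-1 :> R by rewrite invr_gt0.
have eB s : 0 <= s ->
  Re (envelope r s) <= 0 + (4^-1 + r / 2) * s - 4^-1 * s ^+ 2 by [].
have H1 := gauss_dominated d0 (exp_bounded_cst 1) eB.
have H2 := gauss_dominated d0 (exp_bounded_affine 0 w) eB.
set C1 := _ * expR _ in H1; set C2 := _ * expR _ in H2.
exists (C1 + C2); have C1_0 := dominated_ge0 H1; have C2_0 := dominated_ge0 H2.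
split; last by apply: dominatedW H2; lra.
move=> s s0; have := dominatedW (_ : C1 <= C1 + C2) H1 s0.
by rewrite mul1r; apply; lra.
Qed.

Lemma saddle_envelope m n u s : 1 <= m -> m ^+ 3 = n%:R -> 0 <= s ->
  normc (saddle ((s / m)%:C * w) ^+ n) * normc (cexp ((- u)%:C * (s%:C * w)) * w)
  <= normc (cexp (envelope `|u| s)).
Proof.
move=> m1 mn s0; rewrite [leRHS]normc_cexp /=.
apply: le_trans (ler_pM (normc_ge0 _) (normc_ge0 _)
  (normc_saddle_power m1 mn s0) (normc_wave u s0)) _.
by rewrite -expRD ler_expR; lra.
Qed.

(** The factor 1 + y that is left out has modulus at least 1 on the ray. *)
Lemma normc_saddle_pred m n s : 0 < m -> 0 <= s ->
  normc (saddle ((s / m)%:C * w) ^+ n *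
    cexp (- ((s / m)%:C * w) + half_sqr ((s / m)%:C * w))) <=
  normc (saddle ((s / m)%:C * w) ^+ n.+1).
Proof.
move=> m0 s0; set y := (s / m)%:C * w; set X := _ * _.
have -> : saddle y ^+ n.+1 = (1 + y) * X by rewrite exprSr {2}/saddle /X; ring.
rewrite [leRHS]normcM ler_peMl ?normc_ge0//.
have t0 : 0 <= s / m by rewrite divr_ge0// ltW.
rewrite -(@ler_pXn2r _ 2) ?nnegrE ?normc_ge0 ?ler01// expr1n normc_1Dray//.
by have := sqr_ge0 (s / m); lra.
Qed.

(** Writing T for the limit, (1 + y) (X - T) = (saddle(y)^(n+1) - T) - y T, and
1 + y has modulus at least 1. *)
Lemma normc_saddle_pred_sub m n s : 0 < m -> m ^+ 3 = n.+1%:R -> 0 <= s <= m ->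
  normc (saddle ((s / m)%:C * w) ^+ n *
    cexp (- ((s / m)%:C * w) + half_sqr ((s / m)%:C * w)) - cexp (- (s ^+ 3 / 3))%:C) <=
  expR (2 * s ^+ 4 / m) - 1 + s / m.
Proof.
move=> m0 mn sm; have /andP[s0 _] := sm.
have t0 : 0 <= s / m by rewrite divr_ge0// ltW.
have h := saddle_power_sub m0 mn sm.
set T := cexp (- (s ^+ 3 / 3))%:C in h *; set y := (s / m)%:C * w in h *.
set X := _ * cexp _.
have T1 : normc T <= 1.
  by rewrite normc_cexp expR_le1 /= oppr_le0 divr_ge0 ?exprn_ge0.
have y1 : 1 <= normc (1 + y).
  rewrite -(@ler_pXn2r _ 2) ?nnegrE ?normc_ge0 ?ler01// expr1n normc_1Dray//.
  by have := sqr_ge0 (s / m); lra.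
apply: (le_trans (y := normc ((1 + y) * (X - T)))).
  by rewrite normcM ler_peMl ?normc_ge0.
have -> : (1 + y) * (X - T) = (saddle y ^+ n.+1 - T) - y * T.
  by rewrite exprSr {2}/saddle /X; ring.
rewrite (le_trans (normcB _ _))// lerD// normcM.
have -> : normc y = s / m by rewrite /y normcM normc_airy_dir mulr1 normcR ger0_norm.
by rewrite ler_piMr.
Qed.

Section limit.
Variables (m_ : nat -> R) (u : R).
Hypothesis m1 : forall n, 1 <= m_ n.
Hypothesis m3 : forall n, m_ n ^+ 3 = n.+1%:R.
Hypothesis m_inv : (m_ n)^-1 @[n --> \oo] --> (0 : R).

Let m0 n : 0 < m_ n. Proof. exact: lt_le_trans (m1 n). Qed.

Let saddle_cvg s (K : R) (f : nat -> R) : 0 <= s -> 0 <= K ->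
  (forall n, s <= m_ n -> 0 <= f n <= K * (expR (2 * s ^+ 4 / m_ n) - 1 + s / m_ n)) ->
  f n @[n --> \oo] --> (0 : R).
Proof.
move=> s0 K0 fK.
have bnd : K * (expR (2 * s ^+ 4 / m_ n) - 1 + s / m_ n) @[n --> \oo] --> (0 : R).
  have -> : (0 : R) = K * (expR (2 * s ^+ 4 * 0) - 1 + s * 0).
    by rewrite !mulr0 expR0 subrr addr0 mulr0.
  apply: cvgM; first exact: cvg_cst.
  apply: cvgD; last by apply: cvgM; [exact: cvg_cst|exact: m_inv].
  apply: cvgB; last exact: cvg_cst.
  apply: (cvg_comp (fun n => 2 * s ^+ 4 / m_ n) expR); last exact: continuous_expR.
  by apply: cvgM; [exact: cvg_cst|exact: m_inv].
apply: squeeze_cvgr bnd; last exact: cvg_cst.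
have e0 : 0 < (s + 1)^-1 by rewrite invr_gt0; lra.
move/cvgrPdist_le : m_inv => /(_ _ e0); apply: filterS => n.
have i0 : 0 <= (m_ n)^-1 by rewrite invr_ge0 ltW.
have s1 : 0 < s + 1 by lra.
rewrite sub0r normrN ger0_norm// lef_pV2 ?posrE// => h.
by apply: fK; lra.
Qed.

Lemma cvg_pre_airy :
  Im_integral (pre_airy (m_ n) n.+1 u) @[n --> \oo] --> Im_integral (airy_ray 0 u).
Proof.
have [C [HC _]] := envelope_dominated `|u|.
apply: (@cvg_Im_integral _ C).
- by move=> n; exact: cderivable_pre_airy.
- exact: cderivable_airy_ray.
- move=> n s s0; apply: le_trans (HC s s0).
  by rewrite /pre_airy -mulrA normcM saddle_envelope.
- move=> s s0; pose K := normc (cexp ((- u)%:C * (s%:C * w)) * w).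
  apply: (saddle_cvg s0 (normc_ge0 _ : 0 <= K)) => n sm.
  rewrite normc_ge0 /=.
  have -> : airy_ray 0 u s =
      cexp (- (s ^+ 3 / 3))%:C * (cexp ((- u)%:C * (s%:C * w)) * w).
    by rewrite /airy_ray /airy_exponent cexpD expr0; ring.
  rewrite /pre_airy -mulrA -mulrBl normcM mulrC ler_wpM2l ?normc_ge0//.
  have sI : 0 <= s <= m_ n by rewrite s0.
  apply: le_trans (saddle_power_sub (m0 n) (m3 n) sI) _.
  by rewrite lerDl divr_ge0// ltW.
Qed.

Lemma cvg_pre_airy1 :
  Im_integral (pre_airy1 (m_ n) n u) @[n --> \oo] --> Im_integral (airy_ray 1 u).
Proof.
have [C [_ HC]] := envelope_dominated `|u|.
apply: (@cvg_Im_integral _ C).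
- by move=> n; exact: cderivable_pre_airy1.
- exact: cderivable_airy_ray.
- move=> n s s0; apply: le_trans (HC s s0); rewrite add0r.
  rewrite [leRHS]normcM /pre_airy1 normcM ler_wpM2l ?normc_ge0//.
  rewrite -mulrA normcM.
  apply: le_trans (saddle_envelope u (m1 n) (m3 n) s0).
  by rewrite ler_wpM2r ?normc_ge0// normc_saddle_pred.
- move=> s s0.
  pose K := normc (s%:C * w) * normc (cexp ((- u)%:C * (s%:C * w)) * w).
  have K0 : 0 <= K by rewrite mulr_ge0 ?normc_ge0.
  apply: (saddle_cvg s0 K0) => n sm.
  rewrite normc_ge0 /=.
  have -> : airy_ray 1 u s =
      s%:C * w * (cexp (- (s ^+ 3 / 3))%:C * (cexp ((- u)%:C * (s%:C * w)) * w)).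
    by rewrite /airy_ray /airy_exponent cexpD expr1; ring.
  rewrite /pre_airy1 -mulrBr -[X in X - _]mulrA -mulrBl.
  set D := _ - _; rewrite (normcM (s%:C * w)) (normcM D) /K -[leRHS]mulrA.
  rewrite ler_wpM2l ?normc_ge0// [leLHS]mulrC ler_wpM2l ?normc_ge0//.
  have sI : 0 <= s <= m_ n by rewrite s0.
  exact: normc_saddle_pred_sub.
Qed.

End limit.

(** * Rescaled Hermite integrals *)

(** The constant relating He_n(2 q^3 + u/q) to the rescaled integral when q^6 = n:
the modulus of the integrand at the saddle point q^3, times the length scale q,
up to the normalization 2/sqrt(2 pi). *)
Definition hermite_scale n q u : R :=
  2 / Num.sqrt (2 * pi) *
  (q ^+ (3 * n) * q * expR (n%:R / 2 + q ^+ 2 * u + u ^+ 2 / (2 * q ^+ 2))).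

Section link.
Variables (n : nat) (q u : R).
Hypotheses (q0 : 0 < q) (q6 : q ^+ 6 = n.+1%:R).
Let x : R := 2 * q ^+ 3 + u / q.
Let P : R := q ^+ (3 * n.+1) * q *
  expR (n.+1%:R / 2 + q ^+ 2 * u + u ^+ 2 / (2 * q ^+ 2)).
Let qn0 : q != 0. Proof. by rewrite gt_eqF. Qed.

Let rayE c s : ray c (q / 2) (q * (Num.sqrt 3 / 2)) s = c%:C + s%:C * (q%:C * w).
Proof.
rewrite /ray; congr (_ + _ * _).
by apply: eq_ReIm; rewrite !(Re_mul, Im_mul) /=; ring.
Qed.

Let ray_q3 s : ray (q ^+ 3) (q / 2) (q * (Num.sqrt 3 / 2)) s =
  (q ^+ 3)%:C * (1 + (s / q ^+ 2)%:C * w).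
Proof.
rewrite rayE mulrDr mulr1; congr (_ + _).
rewrite !mulrA -!rmorphM; congr (real_complex_def _ _ * _).
by field.
Qed.

Let exponentE s : half_sqr (ray (q ^+ 3 - x) (q / 2) (q * (Num.sqrt 3 / 2)) s) =
  (n.+1%:R / 2 + q ^+ 2 * u + u ^+ 2 / (2 * q ^+ 2))%:C +
  (n.+1%:R * (- ((s / q ^+ 2)%:C * w) + half_sqr ((s / q ^+ 2)%:C * w))
   + (- u)%:C * (s%:C * w)).
Proof.
(* With t = s w the exponent is (- q^3 - u/q + q t)^2/2, and q^6 = n + 1 turns its
   linear and quadratic terms in t into n + 1 times those of the saddle. *)
rewrite rayE /half_sqr /x -q6.
have -> : (n.+1%:R : R[i]) = (q ^+ 6)%:C by rewrite q6 rmorph_nat.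
apply: eq_ReIm; rewrite ?expr2; rewrite !(Re_add, Im_add, Re_opp, Im_opp, Re_mul, Im_mul) /=.
- by field.
- by field.
Qed.

Let PE : P%:C = (q ^+ 3)%:C ^+ n.+1 * q%:C *
  (expR (n.+1%:R / 2 + q ^+ 2 * u + u ^+ 2 / (2 * q ^+ 2)))%:C.
Proof.
have cM (a b : R) : (a * b)%:C = a%:C * b%:C by exact: rmorphM.
have cX (a : R) k : (a ^+ k)%:C = a%:C ^+ k by exact: rmorphXn.
by rewrite /P exprM cM cM (cX (q ^+ 3) n.+1).
Qed.

Lemma hermite_ray_pre_airy s :
  hermite_ray n.+1 x (q ^+ 3) (q / 2) (q * (Num.sqrt 3 / 2)) s =
  P%:C * pre_airy (q ^+ 2) n.+1 u s.
Proof.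
have dE : (q / 2) +i* (q * (Num.sqrt 3 / 2)) = q%:C * w.
  by apply: eq_ReIm; rewrite !(Re_mul, Im_mul) /=; ring.
rewrite /hermite_ray dE ray_q3 exponentE 2!cexpD cexpMn cexpR /pre_airy /saddle.
rewrite PE.
set y := (s / _)%:C * w; set E := cexp (- y + _); set c := cexp (_ * _).
set Q := (expR _)%:C; move: (q ^+ 3)%:C => q3.
by rewrite (exprMn _ q3) (exprMn _ _ E); ring.
Qed.

Lemma hermite_ray_pre_airy_pred s :
  (q ^+ 3)%:C * hermite_ray n x (q ^+ 3) (q / 2) (q * (Num.sqrt 3 / 2)) s =
  P%:C * (saddle ((s / q ^+ 2)%:C * w) ^+ n *
    cexp (- ((s / q ^+ 2)%:C * w) + half_sqr ((s / q ^+ 2)%:C * w))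
    * cexp ((- u)%:C * (s%:C * w)) * w).
Proof.
have dE : (q / 2) +i* (q * (Num.sqrt 3 / 2)) = q%:C * w.
  by apply: eq_ReIm; rewrite !(Re_mul, Im_mul) /=; ring.
rewrite /hermite_ray dE ray_q3 exponentE 2!cexpD cexpMn cexpR /saddle.
rewrite PE.
set y := (s / _)%:C * w; set E := cexp (- y + _); set c := cexp (_ * _).
set Q := (expR _)%:C; move: (q ^+ 3)%:C => q3.
by rewrite (exprMn _ q3) (exprMn _ _ E) (exprSr E) (exprS q3); ring.
Qed.

End link.
End airy_limit.

Section hermite_edge.
Variables (R : realType) (n : nat) (q u : R).
Hypotheses (q0 : 0 < q) (q6 : q ^+ 6 = n.+1%:R).
Local Notation x := (2 * q ^+ 3 + u / q).
Local Notation c := (q ^+ 3).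
Local Notation p := (q / 2).
Local Notation h := (q * (Num.sqrt 3 / 2)).
Let P : R := q ^+ (3 * n.+1) * q *
  expR (n.+1%:R / 2 + q ^+ 2 * u + u ^+ 2 / (2 * q ^+ 2)).

Let h0 : 0 < h. Proof. by rewrite mulr_gt0// divr_gt0// sqrtr_gt0. Qed.

Let ph : 2 * p ^+ 2 < h ^+ 2.
Proof.
rewrite [h ^+ 2]exprMn sqr_half_sqrt3.
have : 0 < q ^+ 2 by rewrite exprn_gt0.
by rewrite expr_div_n; lra.
Qed.

Let ph1 : p ^+ 2 < h ^+ 2. Proof. by have := sqr_ge0 p; have := ph; lra. Qed.

Let P0 : P != 0.
Proof. by rewrite gt_eqF// !mulr_gt0 ?expR_gt0 ?exprn_gt0. Qed.

Lemma hermite_pre_airy : hermite n.+1 x =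
  hermite_scale n.+1 q u * Im_integral (pre_airy (q ^+ 2) n.+1 u).
Proof.
rewrite (hermiteE n.+1 x c h0 ph) /hermite_scale -[RHS]mulrA; congr (_ * _).
have [C HC] := hermite_ray_dominated n.+1 x c ph1.
have dr := hermite_ray_cderivable n.+1 x c p h.
have -> : Im_integral (pre_airy (q ^+ 2) n.+1 u) = P^-1 * hermite_integral n.+1 x c p h.
  rewrite -(Im_integralZ _ dr HC); apply: eq_Im_integral => s _.
  rewrite (hermite_ray_pre_airy u q0 q6) mulrA -rmorphM mulVf//.
  by rewrite rmorph1 mul1r.
by rewrite -/P mulVKf.
Qed.

Lemma hermite_pre_airy1 : q ^+ 2 * (hermite n.+1 x - q ^+ 3 * hermite n x) =
  hermite_scale n.+1 q u * Im_integral (pre_airy1 (q ^+ 2) n u).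
Proof.
rewrite !(hermiteE _ x c h0 ph) /hermite_scale.
have [C1 H1] := hermite_ray_dominated n.+1 x c ph1.
have [C2 H2] := hermite_ray_dominated n x c ph1.
have d1 := hermite_ray_cderivable n.+1 x c p h.
have d2 := hermite_ray_cderivable n x c p h.
pose D s := (- c)%:C * hermite_ray n x c p h s.
have dD : cderivable D by apply: cderivableM => //; exact: cderivable_cst.
have HD : dominated (`|- c| * C2) D := dominatedZ (- c) H2.
have q2 : q ^+ 2 != 0 by rewrite gt_eqF// exprn_gt0.
have -> : Im_integral (pre_airy1 (q ^+ 2) n u) = (q ^+ 2 / P) *
    (hermite_integral n.+1 x c p h - c * hermite_integral n x c p h).
  rewrite -mulNr -(Im_integralZ (- c) d2 H2) -(Im_integralD d1 dD H1 HD).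
  rewrite -(Im_integralZ _ (cderivableD d1 dD) (dominatedD H1 HD)); apply: eq_Im_integral => s _.
  rewrite /D rmorphN mulNr (hermite_ray_pre_airy_pred u q0 q6).
  rewrite (hermite_ray_pre_airy u q0 q6) -/P -mulrBr pre_airy_sub.
  rewrite [RHS]mulrA [in RHS]mulrA -!rmorphM.
  by rewrite mulfVK// mulfV// rmorph1 mul1r.
move: (hermite_integral n.+1 x c p h) (hermite_integral n x c p h) => a b.
rewrite -/P; move: P P0 (Num.sqrt _) => PP PP0 S.
rewrite [RHS]mulrA -[_ * PP * _]mulrA (_ : PP * (q ^+ 2 / PP) = q ^+ 2); last by field.
by ring.
Qed.

End hermite_edge.

(** * Stirling's formula *)

Section stirling.
Variable R : realType.
Local Notation mu := (@lebesgue_measure R).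
Implicit Types (c s r : R) (n k : nat).

Lemma cvg_inv_of_pow (a : nat -> R) k : (forall n, 0 < a n) ->
  (forall n, n.+1%:R <= a n ^+ k.+1) -> (a n)^-1 @[n --> \oo] --> (0 : R).
Proof.
move=> a0 ak; apply/cvgrPdist_le => e e0.
near=> n.
rewrite sub0r normrN ger0_norm ?invr_ge0 ?(ltW (a0 n))//.
rewrite -[e]invrK lef_pV2 ?posrE ?invr_gt0// ?a0//.
rewrite -(@ler_pXn2r _ k.+1) ?nnegrE ?invr_ge0 ?(ltW e0) ?(ltW (a0 n))//.
apply: le_trans (ak n); apply: (@le_trans _ _ n%:R); last by rewrite ler_nat.
by near: n; exact: nbhs_infty_ger.
Unshelve. all: by end_near. Qed.

Lemma expr_le_fact_expR r k : 0 <= r -> r ^+ k <= (k`!)%:R * expR r.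
Proof.
move=> r0; have f0 j : 0 < (j`!)%:R :> R by rewrite ltr0n fact_gt0.
case: k => [|k].
  by rewrite expr0 fact0 mul1r (le_trans _ (expR_ge1Dx r))//; lra.
have := @expR_ge1Dxn R r k r0 => h.
rewrite mulrC -ler_pdivrMr//; lra.
Qed.

(** Combine r^k <= k! exp(r) with 2 r - r^2/2 <= 2, at r = c + s. *)
Lemma moment_bound c s k : - c <= s ->
  `|(c + s) ^+ k * expR (- ((c + s) ^+ 2 / 2))| <= (k`!)%:R * expR (2 - c) * expR (- s).
Proof.
move=> cs; have r0 : 0 <= c + s by lra.
rewrite ger0_norm ?mulr_ge0 ?exprn_ge0 ?expR_ge0//.
apply: le_trans (ler_wpM2r (expR_ge0 _) (expr_le_fact_expR k r0)) _.
rewrite -!mulrA -!expRD ler_wpM2l// ler_expR.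
have := sqr_ge0 (c + s - 2).
have -> : (c + s - 2) ^+ 2 = (c + s) ^+ 2 - 4 * (c + s) + 4 by ring.
by lra.
Qed.

Lemma is_derive_gauss_shift c s :
  is_derive s 1 (fun s => expR (- ((c + s) ^+ 2 / 2)))
    (- (c + s) * expR (- ((c + s) ^+ 2 / 2))).
Proof.
have d : is_derive s 1 (fun s => - ((c + s) ^+ 2 / 2)) (- (c + s)).
  have -> : (fun s => - ((c + s) ^+ 2 / 2)) = (- 2^-1) \*: ((cst c + id) * (cst c + id)).
    by apply/funext => y; transitivity (- 2^-1 * ((c + y) * (c + y))) => //; field.
  by apply: is_derive_eq; rewrite /GRing.scale /= !fctE; field.
by apply: is_derive_eq (is_derive1_comp _ _) _; rewrite /= mulrC.
Qed.

Lemma is_derive_pow_shift c s k :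
  is_derive s 1 (fun s => (c + s) ^+ k) (k%:R * (c + s) ^+ k.-1).
Proof.
have -> : (fun s => (c + s) ^+ k) = (cst c + id) ^+ k.
  by apply/funext => y; rewrite exprfctE.
by apply: is_derive_eq; rewrite /GRing.scale /= !fctE; ring.
Qed.

(** The integrand of the half-line Gaussian moments, recentred at c so that
Laplace's method needs no change of variables. *)
Definition moment c k s := (c + s) ^+ k * expR (- ((c + s) ^+ 2 / 2)).

Lemma is_derive_moment c k s :
  is_derive s 1 (moment c k) (k%:R * moment c k.-1 s - moment c k.+1 s).
Proof.
have d1 := is_derive_pow_shift c s k; have d2 := is_derive_gauss_shift c s.
have -> : moment c k = (fun s => (c + s) ^+ k) * (fun s => expR (- ((c + s) ^+ 2 / 2))).
  by [].
by apply: is_derive_eq; rewrite /GRing.scale /= /moment (exprS _ k); ring.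
Qed.

Lemma continuous_moment c k : continuous (moment c k).
Proof. exact: derivable_continuous (is_derive_moment c k). Qed.

Lemma integrable_moment c k : mu.-integrable `[- c, +oo[ (EFin \o moment c k).
Proof.
by apply: integrable_decay (@continuous_moment c k) _ => s; exact: moment_bound.
Qed.

(** The derivative of r^k exp(- r^2/2) is (k r^(k-1) - r^(k+1)) exp(- r^2/2). *)
Lemma half_moment_rec c k :
  \int[mu]_(s in `[- c, +oo[) moment c k.+1 s =
  k%:R * \int[mu]_(s in `[- c, +oo[) moment c k.-1 s + moment c k (- c).
Proof.
pose f s := k%:R * moment c k.-1 s - moment c k.+1 s.
pose B := k%:R * ((k.-1`!)%:R * expR (2 - c)) + (k.+1`!)%:R * expR (2 - c)
  + (k`!)%:R * expR (2 - c).
have B0 j : 0 <= (j`!)%:R * expR (2 - c) by rewrite mulr_ge0// expR_ge0.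
have kB0 : 0 <= k%:R * ((k.-1`!)%:R * expR (2 - c)) by rewrite mulr_ge0.
have := @Rintegral_FTC2y_decay R B (- c) f (moment c k) (is_derive_moment c k).
have cf : continuous f.
  move=> s; apply: cvgB; last exact: continuous_moment.
  by apply: cvgM; [exact: cvg_cst|exact: continuous_moment].
move=> /(_ cf) H.
have {}H : \int[mu]_(s in `[- c, +oo[) f s = - moment c k (- c).
  apply: H => s cs; rewrite /B !mulrDl.
    rewrite /f (le_trans (ler_normB _ _))// normrM ger0_norm//.
    have h1 : k%:R * `|moment c k.-1 s| <=
        k%:R * ((k.-1`!)%:R * expR (2 - c)) * expR (- s).
      by rewrite -[leRHS]mulrA ler_wpM2l// moment_bound.
    have h2 := moment_bound k.+1 cs.
    have := mulr_ge0 (B0 k) (expR_ge0 (- s)).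
    by move: h1 h2; rewrite -/(moment c k.+1 s); lra.
  have h2 := moment_bound k cs.
  have := mulr_ge0 (B0 k.+1) (expR_ge0 (- s)).
  have := mulr_ge0 kB0 (expR_ge0 (- s)).
  by move: h2; rewrite -/(moment c k s); lra.
have ik j := @integrable_moment c j.
move: H; rewrite /f RintegralB//; last first.
  apply: (integrable_decay (C := k%:R * ((k.-1`!)%:R * expR (2 - c)))).
    by move=> s; apply: cvgM; [exact: cvg_cst|exact: continuous_moment].
  move=> s cs; rewrite normrM ger0_norm// -[leRHS]mulrA ler_wpM2l//.
  exact: moment_bound.
rewrite RintegralZl//.
by lra.
Qed.

Lemma half_moment_fact c n :
  \int[mu]_(s in `[- c, +oo[) moment c (2 * n).+1 s = 2 ^+ n * (n`!)%:R.
Proof.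
elim: n => [|n IH].
  rewrite muln0 half_moment_rec mul0r add0r /moment subrr !expr0n /= mul0r oppr0.
  by rewrite expR0 expr0.
rewrite half_moment_rec mulnS /= IH /moment subrr expr0n /= mul0r addr0.
by rewrite -mulnS factS exprS !natrM; ring.
Qed.

(** The logarithm of this function is y^3/3 + O(y^4). *)
Definition laplace_ratio (y : R) := (1 + y) * expR (- y + y ^+ 2 / 2).

Lemma laplace_ratio_sub1 (y : R) : `|y| <= 1 ->
  `|laplace_ratio y - 1| <= expR 2 * `|y| ^+ 3.
Proof.
move=> y1; pose d (t : R) := t ^+ 2 * expR (- t + t ^+ 2 / 2).
have dl (t : R) : is_derive t 1 laplace_ratio (d t).
  have de : is_derive t 1 (fun t => expR (- t + t ^+ 2 / 2))
      ((-1 + t) * expR (- t + t ^+ 2 / 2)).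
    have dq : is_derive t 1 (fun t => - t + t ^+ 2 / 2) (-1 + t).
      have -> : (fun t => - t + t ^+ 2 / 2) = (2^-1 \*: (id * id) - id : R -> R).
        by apply/funext => r; transitivity (2^-1 * (r * r) - r) => //; field.
      by apply: is_derive_eq; rewrite /GRing.scale /= ?fctE; field.
    by apply: is_derive_eq (is_derive1_comp _ _) _; rewrite /= mulrC.
  have -> : laplace_ratio = (cst 1 + id) * (fun t => expR (- t + t ^+ 2 / 2)).
    by [].
  by apply: is_derive_eq; rewrite /GRing.scale /= ?fctE /d; ring.
have dle t : `|t| <= `|y| -> `|d t| <= `|y| ^+ 2 * expR 2.
  move=> ty; have t1 : `|t| <= 1 by apply: le_trans y1.
  rewrite normrM normrX [`|expR _|]ger0_norm ?expR_ge0//.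
  apply: ler_pM; rewrite ?exprn_ge0 ?expR_ge0//.
    by rewrite lerXn2r ?nnegrE.
  rewrite ler_expR; move: t1; rewrite ler_norml => /andP[? ?].
  have : t ^+ 2 <= 1 by nra.
  lra.
have l0 : laplace_ratio 0 = 1.
  by rewrite /laplace_ratio oppr0 expr0n /= mul0r !addr0 expR0 mulr1.
have cl a b : {within `[a, b], continuous laplace_ratio}.
  exact/continuous_subspaceT/(derivable_continuous dl).
have -> : expR 2 * `|y| ^+ 3 = `|y| ^+ 2 * expR 2 * `|y| by rewrite exprSr; ring.
have [y0|y0] := leP 0 y.
- have [c + fE] := MVT_segment y0 (fun x _ => dl x) (cl 0 y).
  rewrite in_itv/= => /andP[c0 cy].
  rewrite -[X in _ - X]l0 fE subr0 normrM ler_wpM2r// dle//.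
  by rewrite !ger0_norm.
- have [c + fE] := MVT_segment (ltW y0) (fun x _ => dl x) (cl y 0).
  rewrite in_itv/= => /andP[cy c0].
  rewrite -[X in _ - X]l0 distrC fE sub0r normrM normrN ler_wpM2r// dle//.
  by rewrite (ler0_norm c0) (ltr0_norm y0) lerN2.
Qed.

Lemma norm_expr_sub1 r n : `|r ^+ n - 1| <= expR (n%:R * `|r - 1|) - 1.
Proof.
have := normc_expr_sub1 r%:C n.
by rewrite -rmorphXn -(rmorph1 (real_complex R)) -!rmorphB !normcR.
Qed.

(** For c = sqrt(2n), the integrand of the moment of order 2n + 1 divided by
c^(2n+1) exp(- n). The factor (1 + y) exp(- y), y = s/c >= - 1, lies in [0, 1]. *)
Definition laplace_integrand n c s :=
  (1 + s / c) * ((1 + s / c) * expR (- (s / c))) ^+ (2 * n) * expR (- (s ^+ 2 / 2)).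

Lemma moment_laplace n c s : 0 < c -> c ^+ 2 = (2 * n)%:R ->
  moment c (2 * n).+1 s = c ^+ (2 * n).+1 * expR (- n%:R) * laplace_integrand n c s.
Proof.
move=> c0 c2; have cn : c != 0 by rewrite gt_eqF.
have -> : moment c (2 * n).+1 s = (c * (1 + s / c)) ^+ (2 * n).+1 *
    expR (- n%:R + ((2 * n)%:R * (- (s / c)) + - (s ^+ 2 / 2))).
  rewrite /moment mulrDr mulr1 mulrCA mulfV// mulr1; congr (_ * expR _).
  have -> : n%:R = c ^+ 2 / 2 by rewrite c2 natrM mulrC mulKf.
  by rewrite -c2; field.
rewrite 2!expRD expRM_natl /laplace_integrand !exprMn (exprS (1 + s / c)).
by ring.
Qed.

(** The 2n-th power is at most 1, and (1 + |s|) exp(- s^2/2) <= exp(1 - s^2/4). *)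
Lemma laplace_integrand_bound n c s : 1 <= c -> - c <= s ->
  `|laplace_integrand n c s| <= expR 1 * expR (- (s ^+ 2 / 4)).
Proof.
move=> c1 cs; have c0 : 0 < c by lra.
have y1 : - 1 <= s / c by rewrite ler_pdivlMr// mulN1r.
rewrite /laplace_integrand !normrM [`|expR _|]ger0_norm ?expR_ge0//.
have z1 : `|((1 + s / c) * expR (- (s / c))) ^+ (2 * n)| <= 1.
  rewrite normrX exprn_ile1// normrM [`|expR _|]ger0_norm ?expR_ge0// expRN.
  rewrite ler_pdivrMr ?expR_gt0// mul1r ger0_norm ?expR_ge1Dx//.
  by lra.
have h1 : `|1 + s / c| <= expR `|s|.
  apply: le_trans (expR_ge1Dx _).
  rewrite (le_trans (ler_normD _ _))// normr1 lerD2l normrM normfV (gtr0_norm c0).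
  by rewrite ler_pdivrMr// ler_peMr.
apply: (@le_trans _ _ (expR `|s| * 1 * expR (- (s ^+ 2 / 2)))).
  by rewrite ler_wpM2r ?expR_ge0// ler_pM.
rewrite mulr1 -!expRD ler_expR.
have := sqr_ge0 (`|s| / 2 - 1).
have -> : (`|s| / 2 - 1) ^+ 2 = `|s| ^+ 2 / 4 - `|s| + 1 by field.
by rewrite real_normK ?num_real//; lra.
Qed.

Section stirling_limit.
Let c_ n : R := Num.sqrt (2 * n.+1)%:R.

Let c2 n : c_ n ^+ 2 = (2 * n.+1)%:R.
Proof. by rewrite sqr_sqrtr. Qed.

Let c1 n : 1 <= c_ n.
Proof.
by rewrite -(ler_pXn2r (ltn0Sn 1)) ?nnegrE ?sqrtr_ge0// expr1n c2 ler1n.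
Qed.

Let c0 n : 0 < c_ n. Proof. exact: lt_le_trans (c1 n). Qed.

Let c_inv : (c_ n)^-1 @[n --> \oo] --> (0 : R).
Proof.
apply: (@cvg_inv_of_pow _ 1 c0) => n.
by rewrite c2 ler_nat leq_pmull.
Qed.

Let laplace_cvg s : laplace_integrand n.+1 (c_ n) s @[n --> \oo] --> expR (- s ^+ 2).
Proof.
have y0 : s / c_ n @[n --> \oo] --> (0 : R).
  by rewrite -[X in _ --> X](mulr0 s); apply: cvgM; [exact: cvg_cst|exact: c_inv].
have -> : (fun n => laplace_integrand n.+1 (c_ n) s) = (fun n =>
   (1 + s / c_ n) * (laplace_ratio (s / c_ n) ^+ (2 * n.+1)) * expR (- s ^+ 2)).
  apply/funext => n; rewrite /laplace_integrand /laplace_ratio expRD mulrA.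
  rewrite [in RHS]exprMn -[in RHS]mulrA -[in RHS]mulrA -[in LHS]mulrA.
  congr (_ * (_ * _)); rewrite -expRM_natl -expRD; congr expR.
  by rewrite -c2; field; rewrite gt_eqF.
rewrite -[X in _ --> X]mul1r; apply: cvgM; last exact: cvg_cst.
rewrite -[X in _ --> X]mulr1; apply: cvgM.
  by rewrite -[X in _ --> X]addr0; apply: cvgD => //; exact: cvg_cst.
have ratio_le n : `|s| <= c_ n -> `|laplace_ratio (s / c_ n) ^+ (2 * n.+1) - 1| <=
    expR (expR 2 * `|s| ^+ 3 / c_ n) - 1.
  move=> sc; apply: le_trans (norm_expr_sub1 _ _) _.
  rewrite lerD2r ler_expR -c2.
  have yE : `|s / c_ n| = `|s| / c_ n by rewrite normrM normfV (gtr0_norm (c0 n)).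
  have y1 : `|s / c_ n| <= 1 by rewrite yE ler_pdivrMr// mul1r.
  apply: le_trans (ler_wpM2l (sqr_ge0 _) (laplace_ratio_sub1 y1)) _.
  rewrite yE le_eqVlt; apply/orP; left; apply/eqP; field.
  by rewrite gt_eqF.
apply/subr_cvg0 => /=; apply: norm_cvg0.
have bnd : expR (expR 2 * `|s| ^+ 3 / c_ n) - 1 @[n --> \oo] --> (0 : R).
  have -> : (0 : R) = expR (expR 2 * `|s| ^+ 3 * 0) - 1 by rewrite mulr0 expR0 subrr.
  apply: cvgB; last exact: cvg_cst.
  apply: (cvg_comp (fun n => expR 2 * `|s| ^+ 3 / c_ n) expR); last exact: continuous_expR.
  by apply: cvgM; [exact: cvg_cst|exact: c_inv].
apply: squeeze_cvgr bnd; last exact: cvg_cst.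
have e0 : 0 < (`|s| + 1)^-1 by rewrite invr_gt0; have := normr_ge0 s; lra.
move/cvgrPdist_le : c_inv => /(_ _ e0); apply: filterS => n.
have i0 : 0 <= (c_ n)^-1 by rewrite invr_ge0 ltW.
have s1 : 0 < `|s| + 1 by have := normr_ge0 s; lra.
rewrite sub0r normrN ger0_norm// lef_pV2 ?posrE// => h.
by rewrite normr_ge0 ratio_le//; lra.
Qed.

Let laplace_integral n := \int[mu]_(s in `[- c_ n, +oo[) laplace_integrand n.+1 (c_ n) s.

Let continuous_laplace n : continuous (laplace_integrand n.+1 (c_ n)).
Proof.
have K0 : c_ n ^+ (2 * n.+1).+1 * expR (- n.+1%:R) != 0.
  by rewrite mulf_neq0 ?expf_neq0 ?gt_eqF ?expR_gt0.
have -> : laplace_integrand n.+1 (c_ n) = (fun s =>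
    (c_ n ^+ (2 * n.+1).+1 * expR (- n.+1%:R))^-1 * moment (c_ n) (2 * n.+1).+1 s).
  by apply/funext => s; rewrite moment_laplace// mulKf.
by move=> s; apply: cvgM; [exact: cvg_cst|exact: continuous_moment].
Qed.

Let cvg_laplace_integral : laplace_integral n @[n --> \oo] --> (Num.sqrt pi : R).
Proof.
pose s2 : R := Num.sqrt 2.
have s20 : s2 != 0 by rewrite gt_eqF// sqrtr_gt0.
pose K : R := expR 1 / normal_peak s2.
have K0 : 0 <= K by rewrite divr_ge0 ?expR_ge0 ?normal_peak_ge0.
have KE s : K * normal_pdf 0 s2 s = expR 1 * expR (- (s ^+ 2 / 4)).
  rewrite normal_pdfE// /K /normal_fun subr0 sqr_sqrtr//.
  have pk : normal_peak s2 != 0 by rewrite gt_eqF// normal_peak_gt0.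
  rewrite mulrA mulfVK//; congr (_ * expR _).
  by rewrite mulNr; congr (- (_ / _)); rewrite mulr2n; lra.
have [] := @dominated_convergence _ _ R mu setT measurableT
  (fun n s => ((laplace_integrand n.+1 (c_ n) \_ `[- c_ n, +oo[) s)%:E)
  (fun s => (gauss_fun s)%:E)
  (fun s => (K * normal_pdf 0 s2 s)%:E).
- move=> n; apply/measurable_EFinP.
  apply/(measurable_restrictT _ _).1 => //.
  apply: measurable_funTS; exact: continuous_measurable_fun.
- by apply/measurable_EFinP; exact: measurable_gauss_fun.
- apply: aeW => s _; apply/cvg_EFin; first by near=> n.
  have L : laplace_integrand n.+1 (c_ n) s @[n --> \oo] --> gauss_fun s by exact: laplace_cvg.
  apply: (cvg_trans _ L); apply: near_eq_cvg.
  have e0 : 0 < (`|s| + 1)^-1 by rewrite invr_gt0; have := normr_ge0 s; lra.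
  move/cvgrPdist_le : c_inv => /(_ _ e0); apply: filterS => n.
  have i0 : 0 <= (c_ n)^-1 by rewrite invr_ge0 ltW.
  have s1 : 0 < `|s| + 1 by have := normr_ge0 s; lra.
  rewrite sub0r normrN ger0_norm// lef_pV2 ?posrE// => h.
  rewrite /= patchE mem_set//= in_itv/= andbT.
  by have := ler_norm (- s); rewrite normrN; lra.
- have := integrableZl measurableT K (@integrable_normal_pdf R 0 s2).
  by under eq_fun do rewrite -EFinM.
- apply: aeW => s n _; rewrite lee_fin KE patchE; case: ifPn => [|_].
    by rewrite inE/= in_itv/= andbT => cs; exact: laplace_integrand_bound.
  by rewrite normr0 mulr_ge0 ?expR_ge0.
move=> _ _; rewrite integralT_gauss => /fine_cvg /=.
apply: cvg_trans; apply: near_eq_cvg; near=> n.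
by rewrite /= /laplace_integral Rintegral_mkcond.
Unshelve. all: by end_near. Qed.

(** With c = sqrt(2n) the moment formula reads
n! = n^n exp(- n) sqrt(2n) I_n, where I_n tends to the Gauss integral sqrt pi. *)
Lemma stirling : n.+1%:R ^+ n.+1 * expR (- n.+1%:R) * Num.sqrt (2 * pi * n.+1%:R) /
  ((n.+1)`!)%:R @[n --> \oo] --> (1 : R).
Proof.
have sp : Num.sqrt pi != 0 :> R by rewrite gt_eqF// sqrtr_gt0 pi_gt0.
have factE n : ((n.+1)`!)%:R = n.+1%:R ^+ n.+1 * c_ n * expR (- n.+1%:R) * laplace_integral n.
  have := half_moment_fact (c_ n) n.+1.
  under eq_Rintegral do rewrite (moment_laplace _ (c0 n) (c2 n)).
  rewrite RintegralZl//; last first.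
    pose k := c_ n ^+ (2 * n.+1).+1 * expR (- n.+1%:R).
    have k0 : k != 0 by rewrite mulf_neq0 ?expf_neq0 ?gt_eqF ?expR_gt0.
    apply: (integrable_decay (C := `|k^-1| * (((2 * n.+1).+1`!)%:R * expR (2 - c_ n)))
      (@continuous_laplace n)) => s cs.
    have -> : laplace_integrand n.+1 (c_ n) s = k^-1 * moment (c_ n) (2 * n.+1).+1 s.
      by rewrite moment_laplace// mulKf.
    by rewrite normrM -[leRHS]mulrA ler_wpM2l// moment_bound.
  rewrite -/(laplace_integral n) exprS exprM c2 natrM exprMn => e.
  have t0 : (2 : R) ^+ n.+1 != 0 by rewrite expf_neq0.
  by apply: (mulfI t0); rewrite -e; ring.
rewrite -[X in _ --> X](divff sp).
have : Num.sqrt pi / laplace_integral n @[n --> \oo] --> (Num.sqrt pi / Num.sqrt pi : R).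
  apply: cvgM; first exact: cvg_cst.
  exact: cvgV.
apply: cvg_trans; apply: near_eq_cvg; near=> n.
have f0 : ((n.+1)`!)%:R != 0 :> R by rewrite pnatr_eq0 -lt0n fact_gt0.
have [c_0 n0 e0 I0] : [/\ c_ n != 0, (n.+1%:R ^+ n.+1 : R) != 0,
    expR (- n.+1%:R) != 0 :> R & laplace_integral n != 0].
  move: f0; rewrite factE !mulf_eq0 !negb_or => /andP[/andP[/andP[? ?] ?] ?].
  by split.
have -> : Num.sqrt (2 * pi * n.+1%:R) = Num.sqrt pi * c_ n :> R.
  by rewrite mulrAC mulrC -natrM sqrtrM ?pi_ge0.
rewrite factE; field.
by rewrite I0 e0 c_0 n0.
Unshelve. all: by end_near. Qed.

End stirling_limit.

End stirling.

(** * Exact scaling at the spectral edge *)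

Section edge_scaling.
Variable R : realType.
Implicit Types (u v q : R) (n : nat).

Local Notation edge q u := (2 * q ^+ 3 + u / q).

Definition stirling_ratio n : R :=
  n.+1%:R ^+ n.+1 * expR (- n.+1%:R) * Num.sqrt (2 * pi * n.+1%:R) / ((n.+1)`!)%:R.

(** The factor that multiplies the bilinear combination of rescaled integrals in
n^(-1/6) K_n; it gathers the Gaussian weights, the constants of both Hermite
polynomials and the factorial. *)
Definition edge_weight n q u v : R :=
  q * hermite_weight (edge q u) * hermite_weight (edge q v) *
  hermite_scale n.+1 q u * hermite_scale n.+1 q v / ((n.+1)`!)%:R.

Lemma hermite_weightE (x : R) : hermite_weight x =
  Num.sqrt (Num.sqrt (2 * pi))^-1 * expR (- (x ^+ 2 / 4)).
Proof.
rewrite /hermite_weight sqrtrM ?invr_ge0//; congr (_ * _).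
have -> : expR (- (2^-1 * x ^+ 2)) = expR (- (x ^+ 2 / 4)) ^+ 2.
  by rewrite -expRM_natl; congr expR; field.
by rewrite sqrtr_sqr ger0_norm ?expR_ge0.
Qed.

(** The exponents - x^2/4 - y^2/4 of the weights cancel all the growing terms of the
two Hermite constants, leaving the ratio of Stirling's formula and a factor tending to 1. *)
Lemma edge_weightE n q u v : 0 < q -> q ^+ 6 = n.+1%:R ->
  edge_weight n q u v =
  stirling_ratio n * expR ((u ^+ 2 + v ^+ 2) / 4 * (q ^+ 2)^-1) / pi ^+ 2.
Proof.
move=> q0 q6; have qn : q != 0 by rewrite gt_eqF.
have p0 := pi_gt0 R.
have sN : Num.sqrt (2 * pi * n.+1%:R) = Num.sqrt (2 * pi) * q ^+ 3 :> R.
  rewrite sqrtrM ?mulr_ge0 ?ltW// -q6 (_ : q ^+ 6 = (q ^+ 3) ^+ 2).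
    by rewrite sqrtr_sqr ger0_norm// exprn_ge0// ltW.
  by rewrite -exprM.
rewrite /edge_weight /stirling_ratio sN !hermite_weightE /hermite_scale.
set S := Num.sqrt (2 * pi); set T := Num.sqrt S^-1.
have S0 : S != 0 by rewrite gt_eqF// sqrtr_gt0 mulr_gt0.
have T2 : T ^+ 2 = S^-1 by rewrite sqr_sqrtr// invr_ge0 sqrtr_ge0.
have S2 : pi = S ^+ 2 / 2 by rewrite sqr_sqrtr ?mulr_ge0 ?ltW//; field.
have f0 : ((n.+1)`!)%:R != 0 :> R by rewrite pnatr_eq0 -lt0n fact_gt0.
pose N : R := n.+1%:R.
have qN : q ^+ (3 * n.+1) * q ^+ (3 * n.+1) = N ^+ n.+1.
  by rewrite -exprD -mulnDl exprM q6.
have eE : expR (- (edge q u ^+ 2 / 4)) * expR (- (edge q v ^+ 2 / 4)) *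
   expR (N / 2 + q ^+ 2 * u + u ^+ 2 / (2 * q ^+ 2)) *
   expR (N / 2 + q ^+ 2 * v + v ^+ 2 / (2 * q ^+ 2)) =
   expR (- N) * expR ((u ^+ 2 + v ^+ 2) / 4 * (q ^+ 2)^-1).
  by rewrite -!expRD; congr expR; rewrite /N -q6; field.
move: eE; rewrite -/N.
set e1 := expR (- (edge q u ^+ 2 / 4)); set e2 := expR (- (edge q v ^+ 2 / 4)).
set e3 := expR _; set e4 := expR _; set e5 := expR _; set e6 := expR _ => eE.
transitivity (q ^+ 3 * T ^+ 2 * (4 / S ^+ 2) * (q ^+ (3 * n.+1) * q ^+ (3 * n.+1)) *
  (e1 * e2 * e3 * e4) / ((n.+1)`!)%:R).
  move: (q ^+ (3 * n.+1)) ((n.+1)`!)%:R f0 => Q F F0.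
  by field; rewrite F0 S0.
rewrite eE qN T2 S2; move: ((n.+1)`!)%:R f0 (N ^+ n.+1) => F F0 M.
by field; rewrite F0 S0.
Qed.

Lemma hermite_pred n q u : 0 < q -> q ^+ 6 = n.+1%:R ->
  hermite n (edge q u) = hermite_scale n.+1 q u *
    (Im_integral (pre_airy (q ^+ 2) n.+1 u)
     - Im_integral (pre_airy1 (q ^+ 2) n u) / q ^+ 2) / q ^+ 3.
Proof.
move=> q0 q6; have qn : q != 0 by rewrite gt_eqF.
have h1 := hermite_pre_airy u q0 q6; have h2 := hermite_pre_airy1 u q0 q6.
rewrite h1 in h2; move: h2.
move: (hermite n _) (hermite_scale _ _ _) (Im_integral _) (Im_integral _) => H S A B.
move=> h2.
apply: (mulfI (expf_neq0 5 qn)).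
transitivity (q ^+ 2 * (S * B) - q ^+ 2 * (S * B - q ^+ 3 * H)); first by ring.
by rewrite h2; field.
Qed.

(** Replacing q^3 He_n by He_(n+1) - q^3 He_n at both points changes only the sign of
the antisymmetric Christoffel-Darboux expression, since the subtracted terms are
proportional to He_(n+1)(x) He_(n+1)(y). *)
Lemma hermite_kernel_offdiag n q u v : 0 < q -> q ^+ 6 = n.+1%:R -> u != v ->
  q^-1 * hermite_kernel n.+1 (edge q u) (edge q v) =
  edge_weight n q u v *
  ((Im_integral (pre_airy1 (q ^+ 2) n u) * Im_integral (pre_airy (q ^+ 2) n.+1 v) -
    Im_integral (pre_airy (q ^+ 2) n.+1 u) * Im_integral (pre_airy1 (q ^+ 2) n v))
   / (u - v)).
Proof.
move=> q0 q6 uv; have qn : q != 0 by rewrite gt_eqF.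
have uv0 : u - v != 0 by rewrite subr_eq0.
have f0 : (n`!)%:R != 0 :> R by rewrite pnatr_eq0 -lt0n fact_gt0.
rewrite hermite_kernelE /edge_weight.
have := christoffel_darboux n (edge q u) (edge q v).
rewrite !(hermite_pred _ q0 q6) !(hermite_pre_airy _ q0 q6) factS natrM -q6.
set S := \sum_(_ < _) _.
move: S (hermite_weight _) (hermite_weight _) (hermite_scale _ _ _) (hermite_scale _ _ _).
move: (Im_integral _) (Im_integral _) (Im_integral _) (Im_integral _) (n`!)%:R f0.
move=> A B C D F F0 S W1 W2 S1 S2 E.
have xy : edge q u - edge q v = (u - v) / q by field.
have ES : S = q / (u - v) * ((edge q u - edge q v) * S) by rewrite xy; field; rewrite uv0 qn.
rewrite {}ES {}E.
by field; rewrite F0 qn uv0.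
Qed.

(** With a = He_(n+1) and b = q^3 He_n the confluent formula is
a^2 + b^2 - (x/q^3) a b = (a - b)^2 - (u/q^4) a b, because x/q^3 = 2 + u/q^4. *)
Lemma hermite_kernel_ondiag n q u : 0 < q -> q ^+ 6 = n.+1%:R ->
  q^-1 * hermite_kernel n.+1 (edge q u) (edge q u) =
  edge_weight n q u u *
  (Im_integral (pre_airy1 (q ^+ 2) n u) ^+ 2 -
   u * Im_integral (pre_airy (q ^+ 2) n.+1 u) *
   (Im_integral (pre_airy (q ^+ 2) n.+1 u) -
    Im_integral (pre_airy1 (q ^+ 2) n u) * (q ^+ 2)^-1)).
Proof.
move=> q0 q6; have qn : q != 0 by rewrite gt_eqF.
have f0 : (n`!)%:R != 0 :> R by rewrite pnatr_eq0 -lt0n fact_gt0.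
rewrite hermite_kernelE /edge_weight christoffel_darboux_diag.
rewrite !(hermite_pred _ q0 q6) !(hermite_pre_airy _ q0 q6) factS natrM -q6.
move: (hermite_weight _) (hermite_scale _ _ _) (Im_integral _) (Im_integral _).
move: (n`!)%:R f0 => F F0 W S A B.
by field; rewrite F0 qn.
Qed.

End edge_scaling.

(** * The edge limit *)

Section edge_limit.
Variable R : realType.
Implicit Types (u v : R).

(** The index is shifted by one to avoid the division by zero at n = 0. *)
Definition sixth_root n : R := n.+1%:R `^ (6^-1).
Local Notation q := sixth_root.

Lemma sixth_root_gt0 n : 0 < q n. Proof. by rewrite powR_gt0. Qed.

Lemma sixth_root_expr n : q n ^+ 6 = n.+1%:R.
Proof.
by rewrite -powR_mulrn ?powR_ge0// -powRrM mulVf// powRr1.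
Qed.

Lemma sixth_root_sqrt n : Num.sqrt n.+1%:R = q n ^+ 3.
Proof.
rewrite -sixth_root_expr (_ : q n ^+ 6 = (q n ^+ 3) ^+ 2); last by rewrite -exprM.
by rewrite sqrtr_sqr ger0_norm// exprn_ge0// powR_ge0.
Qed.

Lemma sixth_root_cube n : (q n ^+ 2) ^+ 3 = n.+1%:R.
Proof. by rewrite -exprM sixth_root_expr. Qed.

Lemma sixth_root_sqr_ge1 n : 1 <= q n ^+ 2.
Proof.
rewrite -(@ler_pXn2r _ 3) ?nnegrE ?exprn_ge0 ?powR_ge0//.
by rewrite expr1n sixth_root_cube ler1n.
Qed.

Lemma cvg_sixth_root_inv : (q n ^+ 2)^-1 @[n --> \oo] --> (0 : R).
Proof.
apply: (@cvg_inv_of_pow _ _ 2) => n; first by rewrite exprn_gt0// sixth_root_gt0.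
by rewrite sixth_root_cube.
Qed.

Lemma cvg_edge_weight u v : edge_weight n (q n) u v @[n --> \oo] --> (pi ^- 2 : R).
Proof.
have -> : (fun n => edge_weight n (q n) u v) = (fun n =>
    stirling_ratio R n * expR ((u ^+ 2 + v ^+ 2) / 4 * (q n ^+ 2)^-1) / pi ^+ 2).
  by apply/funext => n; rewrite edge_weightE ?sixth_root_gt0 ?sixth_root_expr.
have e1 : expR ((u ^+ 2 + v ^+ 2) / 4 * (q n ^+ 2)^-1) @[n --> \oo] --> (1 : R).
  rewrite -[X in _ --> X]expR0 -[X in _ --> expR X](mulr0 ((u ^+ 2 + v ^+ 2) / 4)).
  apply: (cvg_comp (fun n => (u ^+ 2 + v ^+ 2) / 4 * (q n ^+ 2)^-1) expR).
    by apply: cvgM; [exact: cvg_cst|exact: cvg_sixth_root_inv].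
  exact: continuous_expR.
rewrite -[X in _ --> X]mul1r; apply: cvgM; last exact: cvg_cst.
by rewrite -[X in _ --> X]mul1r; apply: cvgM => //; exact: stirling.
Qed.

Lemma cvg_edge_airy u :
  Im_integral (pre_airy (q n ^+ 2) n.+1 u) @[n --> \oo] --> pi * airy u.
Proof.
have -> : pi * airy u = Im_integral (airy_ray 0 u).
  by rewrite airyE mulVKf// gt_eqF// pi_gt0.
exact: (@cvg_pre_airy R (fun n => q n ^+ 2) u
  sixth_root_sqr_ge1 sixth_root_cube cvg_sixth_root_inv).
Qed.

Lemma cvg_edge_airy' u :
  Im_integral (pre_airy1 (q n ^+ 2) n u) @[n --> \oo] --> - (pi * airy' u).
Proof.
have -> : - (pi * airy' u) = Im_integral (airy_ray 1 u).
  by rewrite /airy' mulrN opprK mulVKf// gt_eqF// pi_gt0.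
exact: (@cvg_pre_airy1 R (fun n => q n ^+ 2) u
  sixth_root_sqr_ge1 sixth_root_cube cvg_sixth_root_inv).
Qed.

Lemma cvg_edge_kernel_diag u :
  (q n)^-1 * hermite_kernel n.+1 (2 * q n ^+ 3 + u / q n) (2 * q n ^+ 3 + u / q n)
    @[n --> \oo] --> airy_kernel u u.
Proof.
have p0 : pi != 0 :> R by rewrite gt_eqF// pi_gt0.
rewrite airy_kernel_diag.
rewrite (eq_cvg _ _ (fun n =>
  hermite_kernel_ondiag u (sixth_root_gt0 n) (sixth_root_expr n))).
have -> : airy' u ^+ 2 - u * airy u ^+ 2 = pi ^- 2 *
    ((- (pi * airy' u)) ^+ 2 - u * (pi * airy u) *
       (pi * airy u - (- (pi * airy' u)) * 0)).
  by move: p0 (airy u) (airy' u); move: (pi : R) => P p0 a b; field.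
have cA := @cvg_edge_airy u; have cB := @cvg_edge_airy' u.
apply: cvgM; first exact: cvg_edge_weight.
apply: cvgB; first by apply: cvgM.
apply: cvgM; first by apply: cvgM; [exact: cvg_cst|].
by apply: cvgB => //; apply: cvgM => //; exact: cvg_sixth_root_inv.
Qed.

Lemma cvg_edge_kernel_offdiag u v : u != v ->
  (q n)^-1 * hermite_kernel n.+1 (2 * q n ^+ 3 + u / q n) (2 * q n ^+ 3 + v / q n)
    @[n --> \oo] --> airy_kernel u v.
Proof.
move=> uv; have p0 : pi != 0 :> R by rewrite gt_eqF// pi_gt0.
rewrite airy_kernel_offdiag//.
rewrite (eq_cvg _ _ (fun n =>
  hermite_kernel_offdiag (sixth_root_gt0 n) (sixth_root_expr n) uv)).
have -> : (airy u * airy' v - airy' u * airy v) / (u - v) = pi ^- 2 *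
    (((- (pi * airy' u)) * (pi * airy v) - (pi * airy u) * (- (pi * airy' v))) / (u - v)).
  have uv0 : u - v != 0 by rewrite subr_eq0.
  move: p0 (airy u) (airy' u) (airy v) (airy' v); move: (pi : R) => P p0 a b c d.
  by field; rewrite uv0 p0.
apply: cvgM; first exact: cvg_edge_weight.
apply: cvgM; last exact: cvg_cst.
apply: cvgB; apply: cvgM.
- exact: cvg_edge_airy'.
- exact: cvg_edge_airy.
- exact: cvg_edge_airy.
- exact: cvg_edge_airy'.
Qed.

End edge_limit.

Theorem proposition4p16 (R : realType) (u v : R) :
  (n%:R `^ (- 6^-1)
    * hermite_kernel n (2 * Num.sqrt n%:R + n%:R `^ (- 6^-1) * u)
                       (2 * Num.sqrt n%:R + n%:R `^ (- 6^-1) * v))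
    @[n --> \oo] --> airy_kernel u v.
Proof.
rewrite -cvg_shiftS /=.
have qE (n : nat) (z : R) : 2 * Num.sqrt n.+1%:R + n.+1%:R `^ (- 6^-1) * z =
    2 * sixth_root R n ^+ 3 + z / sixth_root R n.
  by rewrite powRN sixth_root_sqrt [_^-1 * z]mulrC.
under eq_cvg do rewrite !qE powRN -/(sixth_root R _).
have [<-|uv] := eqVneq u v; first exact: cvg_edge_kernel_diag.
exact: cvg_edge_kernel_offdiag.
Qed.
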